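(* Let $\mathcal{P}=(H,V_{\uparrow},\rho_{\uparrow},\phi_{\uparrow},V^{\downarrow},\rho^{\downarrow},\phi^{\downarrow})$ and $\hat{\mathcal{P}}=(H,V_{\uparrow},\hat\rho_{\uparrow},\phi_{\uparrow},V^{\downarrow},\hat\rho^{\downarrow},\phi^{\downarrow})$ be two filtered matched pairs with the same data $H,V^{\downarrow},V_{\uparrow},\phi^{\downarrow},\phi_{\uparrow}$ but possibly different filtration functions, and let $$t=\max\left\{\max_{V^{\downarrow}\setminus\{0\}}|\rho^{\downarrow}-\hat\rho^{\downarrow}|,\ \max_{V_{\uparrow}\setminus\{0\}}|\rho_{\uparrow}-\hat\rho_{\uparrow}|\right\}.$$ Then the gaps satisfy $|G_i(\mathcal{P})-G_i(\hat{\mathcal{P}})|\le 2t$ for all $i$. Moreover, if $\Gamma$ is discrete (so that the basis spectra $\Sigma(\mathcal{P})$ and $\Sigma(\hat{\mathcal{P}})$ are well defined), then there is a bijection of multisets $\sigma:\Sigma(\mathcal{P})\to\Sigma(\hat{\mathcal{P}})$ such that for each $([a],\ell)\in\Sigma(\mathcal{P})$ the image $([\hat a],\hat\ell)=\sigma([a],\ell)$ satisfies, for some choice of $\hat a$ within its $\Gamma$-coset, $$|\hat a-a|\le t\quad\text{and}\quad |(\hat a+\hat\ell)-(a+\ell)|\le t.$$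
   Context: Fix a field $\kappa$ and a finitely generated additive subgroup $\Gamma\le\mathbb{R}$. $\Lambda=\kappa[\Gamma]$ is the group algebra, written as finite sums $\sum_{g\in\Gamma}a_gT^g$, $a_g\in\kappa$. $\Lambda_{\uparrow}$ (resp. $\Lambda^{\downarrow}$) is the field of formal sums $\sum_{g\in\Gamma}a_gT^g$ such that for every $C\in\mathbb{R}$ only finitely many $g$ with $g<C$ (resp. $g>-C$) have $a_g\ne0$. $\nu_{\uparrow}(\sum a_gT^g)=\min\{g: a_g\neq 0\}$ on $\Lambda_{\uparrow}$ ($\nu_\uparrow(0)=+\infty$), $\nu^{\downarrow}(\sum a_gT^g)=\max\{g:a_g\ne0\}$ on $\Lambda^{\downarrow}$ ($\nu^{\downarrow}(0)=-\infty$). A normed $\Lambda_{\uparrow}$-space $(V_{\uparrow},\rho_{\uparrow})$ is a finite-dimensional $\Lambda_{\uparrow}$-vector space with $\rho_{\uparrow}:V_{\uparrow}\to\mathbb{R}\cup\{-\infty\}$ such that $\rho_{\uparrow}(x)=-\infty$ iff $x=0$; $\rho_{\uparrow}(\lambda x)=\rho_{\uparrow}(x)-\nu_{\uparrow}(\lambda)$; $\rho_{\uparrow}(x+y)\le\max\{\rho_{\uparrow}(x),\rho_{\uparrow}(y)\}$. A normed $\Lambda^{\downarrow}$-space $(V^{\downarrow},\rho^{\downarrow})$ is a finite-dimensional $\Lambda^{\downarrow}$-vector space with $\rho^{\downarrow}:V^{\downarrow}\to\mathbb{R}\cup\{\infty\}$ such that $\rho^{\downarrow}(x)=\infty$ iff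 $x=0$; $\rho^{\downarrow}(\lambda x)=\rho^{\downarrow}(x)-\nu^{\downarrow}(\lambda)$; $\rho^{\downarrow}(x+y)\ge\min\{\rho^{\downarrow}(x),\rho^{\downarrow}(y)\}$. A subset $\{x_1,\dots,x_k\}$ is $\rho_{\uparrow}$-orthogonal if $\rho_{\uparrow}(\sum\lambda_ix_i)=\max_i(\rho_{\uparrow}(x_i)-\nu_{\uparrow}(\lambda_i))$ for all $\lambda_i\in\Lambda_{\uparrow}$, and $\rho^{\downarrow}$-orthogonal if $\rho^{\downarrow}(\sum\lambda_ix_i)=\min_i(\rho^{\downarrow}(x_i)-\nu^{\downarrow}(\lambda_i))$ for all $\lambda_i\in\Lambda^{\downarrow}$. A filtered matched pair $\mathcal{P}=(H,V_{\uparrow},\rho_{\uparrow},\phi_{\uparrow},V^{\downarrow},\rho^{\downarrow},\phi^{\downarrow})$ consists of a finitely generated $\Lambda$-module $H$, a normed $\Lambda_{\uparrow}$-space $(V_{\uparrow},\rho_{\uparrow})$, a normed $\Lambda^{\downarrow}$-space $(V^{\downarrow},\rho^{\downarrow})$, and $\Lambda$-module homomorphisms $\phi_{\uparrow}:H\to V_{\uparrow}$, $\phi^{\downarrow}:H\to V^{\downarrow}$ such that $1\otimes\phi_{\uparrow}:\Lambda_{\uparrow}\otimes_{\Lambda}H\to V_{\uparrow}$ and $1\otimes\phi^{\downarrow}:\Lambda^{\downarrow}\otimes_{\Lambda}H\to V^{\downarrow}$ are isomorphisms. Let $d=\dim_{\mathcal{Q}(\Lambda)}\mathcal{Q}(\Lambda)\otimes_\Lambda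 H$, where $\mathcal{Q}(\Lambda)$ is the fraction field. For $1\le i\le d$ the $i$th gap $G_i(\mathcal{P})$ is the supremum of the $\gamma\in\mathbb{R}$ for which there exist $\Lambda$-independent $x_1,\dots,x_i\in H$ with $\rho^{\downarrow}(\phi^{\downarrow}x_j)-\rho_{\uparrow}(\phi_{\uparrow}x_j)\ge\gamma$ for all $j\le i$. A doubly-orthogonal basis of $\mathcal{P}$ is a subset $\{e_1,\dots,e_d\}\subset H$ projecting to a basis of the $\Lambda$-module $H/tH$ ($tH$ the $\Lambda$-torsion submodule) such that $\{\phi_{\uparrow}e_i\}$ is a $\rho_{\uparrow}$-orthogonal basis of $V_{\uparrow}$ and $\{\phi^{\downarrow}e_i\}$ is a $\rho^{\downarrow}$-orthogonal basis of $V^{\downarrow}$. If one exists (as it always does when $\Gamma$ is discrete), the basis spectrum $\Sigma(\mathcal{P})$ is the multiset of the pairs $([\rho_{\uparrow}(\phi_{\uparrow}e_i)],\ \rho^{\downarrow}(\phi^{\downarrow}e_i)-\rho_{\uparrow}(\phi_{\uparrow}e_i))\in(\mathbb{R}/\Gamma)\times\mathbb{R}$, $i=1,\dots,d$; it is independent of the choice of doubly-orthogonal basis. *)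

(* Defs.v *)
From HB Require Import structures.
From mathcomp Require Import all_boot all_order all_algebra.
From mathcomp Require Import finmap multiset.
From mathcomp Require Import all_classical all_reals all_analysis.
From mathcomp Require Import ring_quotient.
Import Order.TTheory GRing.Theory Num.Theory.
Import numFieldNormedType.Exports.

Set Implicit Arguments.
Unset Strict Implicit.
Unset Printing Implicit Defensive.

Local Open Scope classical_set_scope.
Local Open Scope ring_scope.

(* The group algebra and the two Novikov fields are the three instances of one
   construction: formal sums of monomials T^g whose support satisfies a
   finiteness condition stable under unions and under pointwise sums. *)

Inductive support_kind := Finite | Upward | Downward.

Definition admissible (R : realType) (k : support_kind) (A : set R) : Prop :=
  match k with
  | Finite => finite_set A
  | Upward => forall C : R, finite_set (A `&` [set g | g < C])
  | Downward => forall C : R, finite_set (A `&` [set g | - C < g])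
  end.

Record series (R : realType) (K : fieldType) (Gamma : zmodClosed R)
    (k : support_kind) := Series {
  coef :> R -> K ;
  coef_Gamma : forall g, coef g != 0 -> g \in Gamma ;
  coef_admissible : admissible k [set g | coef g != 0]
}.

Section Admissible.
Context {R : realType}.
Implicit Types (k : support_kind) (A B : set R).

Lemma admissibleS k A B : A `<=` B -> admissible k B -> admissible k A.
Proof.
by case: k => /= sAB; [exact: sub_finite_set|move=> h C|move=> h C];
  apply: sub_finite_set (h C); exact: setSI.
Qed.

Lemma admissibleU k A B :
  admissible k A -> admissible k B -> admissible k (A `|` B).
Proof.
by case: k => /= hA hB; [rewrite finite_setU|move=> C|move=> C];
  rewrite ?setIUl ?finite_setU.
Qed.

Lemma finite_admissible k A : finite_set A -> admissible k A.
Proof.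
by case: k => //= hA C; apply: sub_finite_set hA; exact: subIsetl.
Qed.

Lemma admissibleN_up A : admissible Upward A ->
  admissible Downward [set g | A (- g)].
Proof.
move=> hA C; have := hA C => /= h.
apply: (@sub_finite_set _ _ (-%R @` (A `&` [set g | g < C]))).
  by move=> g /= [Ag Cg]; exists (- g); rewrite ?opprK //; split => //=; rewrite ltrNl.
exact: finite_image.
Qed.

Lemma admissibleN_down A : admissible Downward A ->
  admissible Upward [set g | A (- g)].
Proof.
move=> hA C; have := hA C => /= h.
apply: (@sub_finite_set _ _ (-%R @` (A `&` [set g | - C < g]))).
  by move=> g /= [Ag Cg]; exists (- g); rewrite ?opprK //; split => //=; rewrite ltrN2.
exact: finite_image.
Qed.

Lemma up_bounded_below A : admissible Upward A ->
  exists m : R, forall g, A g -> m <= g.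
Proof.
move=> hA; have /finite_seqP[s hs] := hA 0.
exists (- \sum_(x <- s) `|x|) => g Ag.
have [g0|g0] := leP 0 g; first by apply: le_trans g0; rewrite oppr_le0 sumr_ge0.
have : [set` s] g by rewrite -hs; split.
move=> /= gs; rewrite lerNl (big_rem g) //=.
by apply: le_trans (ler_norm _) _; rewrite normrN lerDl sumr_ge0.
Qed.

Lemma up_fiber_finite A B h : admissible Upward A -> admissible Upward B ->
  finite_set [set a | A a /\ B (h - a)].
Proof.
move=> hA hB; have [m hm] := up_bounded_below hB.
apply: sub_finite_set (hA (h - m + 1)) => a [Aa /hm mB]; split => //=.
by rewrite ltr_pwDr// lerBrDr addrC -lerBrDr.
Qed.

Definition sumset A B : set R := [set x + y | x in A & y in B].

Lemma up_sumset A B : admissible Upward A -> admissible Upward B ->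
  admissible Upward (sumset A B).
Proof.
move=> hA hB C; have [m hm] := up_bounded_below hA.
have [n hn] := up_bounded_below hB.
apply: (@sub_finite_set _ _
  [set x + y | x in A `&` [set g | g < C - n] & y in B `&` [set g | g < C - m]]).
  move=> _ [[x Ax [y By <-]] /= ltC]; exists x.
    by split => //=; rewrite ltrBrDr; apply: le_lt_trans ltC; rewrite lerD2l hn.
  exists y => //; split => //=; rewrite ltrBrDl.
  by apply: le_lt_trans ltC; rewrite lerD2r hm.
exact: finite_image2.
Qed.

Lemma admissible_fiber k A B h : admissible k A -> admissible k B ->
  finite_set [set a | A a /\ B (h - a)].
Proof.
case: k => hA hB.
- by apply: sub_finite_set hA => a [].
- exact: up_fiber_finite.
- have h1 := up_fiber_finite (- h) (admissibleN_down hA) (admissibleN_down hB).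
  apply: (@sub_finite_set _ _ (-%R @` _)) (finite_image _ h1).
  by move=> a [Aa Ba]; exists (- a); rewrite /= ?opprK // opprD !opprK.
Qed.

Lemma admissible_sumset k A B : admissible k A -> admissible k B ->
  admissible k (sumset A B).
Proof.
case: k => hA hB; [exact: finite_image2|exact: up_sumset|].
have := admissibleN_up (up_sumset (admissibleN_down hA) (admissibleN_down hB)).
apply: admissibleS => _ [x Ax [y By <-]] /=.
by exists (- x); rewrite /= ?opprK //; exists (- y); rewrite /= ?opprK // -opprD.
Qed.

End Admissible.

Section SeriesRing.
Context {R : realType} {K : fieldType} {Gamma : zmodClosed R}.

Section AnyKind.
Context {k : support_kind}.
Notation S := (series K Gamma k).
Implicit Types (f : S).

Lemma coef_inj (f g : S) : coef f =1 coef g -> f = g.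
Proof.
case: f g => [f f1 f2] [g g1 g2] /= /funext efg; case: g / efg g1 g2 => g1 g2.
by rewrite (Prop_irrelevance f1 g1) (Prop_irrelevance f2 g2).
Qed.

HB.instance Definition _ := gen_eqMixin S.
HB.instance Definition _ := gen_choiceMixin S.

Fact zero_Gamma (g : R) : (0 : K) != 0 -> g \in Gamma.
Proof. by rewrite eqxx. Qed.
Fact zero_admissible : admissible k [set g : R | (0 : K) != 0].
Proof.
apply: finite_admissible; rewrite (_ : [set _ | _] = set0) //.
by apply/seteqP; split => // g /=; rewrite eqxx.
Qed.
Definition series_zero : S := Series zero_Gamma zero_admissible.

Fact opp_Gamma f g : - f g != 0 -> g \in Gamma.
Proof. by rewrite oppr_eq0; exact: coef_Gamma. Qed.
Fact opp_admissible f : admissible k [set g | - f g != 0].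
Proof.
by apply: admissibleS (coef_admissible f) => g /=; rewrite oppr_eq0.
Qed.
Definition series_opp f : S := Series (@opp_Gamma f) (opp_admissible f).

Fact add_supp f1 f2 g : f1 g + f2 g != 0 -> f1 g != 0 \/ f2 g != 0.
Proof. by have [->|] := eqVneq (f1 g) 0; [rewrite add0r; right|left]. Qed.
Fact add_Gamma f1 f2 g : f1 g + f2 g != 0 -> g \in Gamma.
Proof. by move/add_supp => []; exact: coef_Gamma. Qed.
Fact add_admissible f1 f2 : admissible k [set g | f1 g + f2 g != 0].
Proof.
apply: admissibleS (admissibleU (coef_admissible f1) (coef_admissible f2)).
by move=> g /=; exact: add_supp.
Qed.
Definition series_add f1 f2 : S :=
  Series (@add_Gamma f1 f2) (add_admissible f1 f2).

Fact series_addA : associative series_add.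
Proof. by move=> f g u; apply: coef_inj => x /=; rewrite addrA. Qed.
Fact series_addC : commutative series_add.
Proof. by move=> f g; apply: coef_inj => x /=; rewrite addrC. Qed.
Fact series_add0 : left_id series_zero series_add.
Proof. by move=> f; apply: coef_inj => x /=; rewrite add0r. Qed.
Fact series_addN : left_inverse series_zero series_opp series_add.
Proof. by move=> f; apply: coef_inj => x /=; rewrite addNr. Qed.

HB.instance Definition _ :=
  GRing.isZmodule.Build S series_addA series_addC series_add0 series_addN.

Fact mono_Gamma (c : K) (g0 : R) : g0 \in Gamma ->
  forall g, (if g == g0 then c else 0) != 0 -> g \in Gamma.
Proof. by move=> hg g; case: (g =P g0) => [->//|_]; rewrite eqxx. Qed.
Fact mono_admissible (c : K) (g0 : R) :
  admissible k [set g | (if g == g0 then c else 0) != 0].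
Proof.
apply: finite_admissible; apply: (@sub_finite_set _ _ [set g0]) => // g /=.
by case: (g =P g0) => // _; rewrite eqxx.
Qed.
Definition mono (c : K) (g0 : R) (hg : g0 \in Gamma) : S :=
  Series (mono_Gamma hg) (mono_admissible c g0).

Definition series_one : S := mono 1 (rpred0 Gamma).

(* the sum has finitely many nonzero terms, by [admissible_fiber] *)
Definition conv f1 f2 (h : R) : K := \sum_(a \in [set: R]) f1 a * f2 (h - a).

Lemma conv_fiber f1 f2 h : finite_set [set a | f1 a != 0 /\ f2 (h - a) != 0].
Proof. exact: admissible_fiber (coef_admissible f1) (coef_admissible f2). Qed.

Lemma convE f1 f2 h (s : seq R) : uniq s ->
  (forall a, f1 a != 0 -> f2 (h - a) != 0 -> a \in s) ->
  conv f1 f2 h = \sum_(a <- s) f1 a * f2 (h - a).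
Proof.
move=> us hs; rewrite /conv [RHS]fsbig_seq //; apply/esym/fsbig_widen => //.
move=> a [_ /= nas]; apply: contra_notP nas => /eqP; rewrite mulf_eq0 negb_or.
by case/andP => *; exact: hs.
Qed.

Lemma conv_supp f1 f2 : [set g | conv f1 f2 g != 0] `<=`
  sumset [set g | f1 g != 0] [set g | f2 g != 0].
Proof.
move=> h /= nz; have [a] : exists a, f1 a * f2 (h - a) != 0.
  apply: contraPP nz => /forallNP nz; apply/negP; rewrite negbK.
  apply/eqP/fsbig1 => a _; apply/eqP/negbNE/negP; exact: nz.
rewrite mulf_eq0 negb_or => /andP[h1 h2].
by exists a => //; exists (h - a) => //; rewrite addrC subrK.
Qed.

Fact conv_Gamma f1 f2 g : conv f1 f2 g != 0 -> g \in Gamma.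
Proof.
move/conv_supp => [x /coef_Gamma hx [y /coef_Gamma hy <-]]; exact: rpredD.
Qed.
Fact conv_admissible f1 f2 : admissible k [set g | conv f1 f2 g != 0].
Proof.
apply: admissibleS (@conv_supp f1 f2) _.
exact: admissible_sumset (coef_admissible f1) (coef_admissible f2).
Qed.
Definition series_mul f1 f2 : S :=
  Series (@conv_Gamma f1 f2) (conv_admissible f1 f2).

Lemma conv_seq f1 f2 h : {s : seq R | uniq s &
  forall a, f1 a != 0 -> f2 (h - a) != 0 -> a \in s}.
Proof.
exists (fset_set [set a | f1 a != 0 /\ f2 (h - a) != 0]); first exact: fset_uniq.
by move=> a ? ?; rewrite in_fset_set; [rewrite inE|exact: conv_fiber].
Qed.

Fact series_mulC : commutative series_mul.
Proof.
move=> f g; apply: coef_inj => h /=.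
have [s us hs] := conv_seq f g h.
rewrite (convE us hs) (@convE g f h [seq h - a | a <- s]).
- by rewrite big_map; apply: eq_bigr => a _; rewrite subKr mulrC.
- by rewrite map_inj_uniq // => x y /addrI /oppr_inj.
- move=> a ga fa; apply/mapP; exists (h - a); last by rewrite subKr.
  by apply: hs => //; rewrite subKr.
Qed.

Fact series_mul1 : left_id series_one series_mul.
Proof.
move=> f; apply: coef_inj => h /=; rewrite (@convE _ _ _ [:: 0]) //=.
  by rewrite big_seq1 /= eqxx mul1r subr0.
by move=> a; rewrite inE; case: (a =P _) => //; rewrite eqxx.
Qed.

Fact series_mulDl : left_distributive series_mul series_add.
Proof.
move=> f g u; apply: coef_inj => h /=.
have [s us hs] := conv_seq f u h; have [t ut ht] := conv_seq g u h.
have uw := undup_uniq (s ++ t).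
rewrite (@convE (series_add f g) u h _ uw); last first.
  by move=> a /= /add_supp[] fa ua; rewrite mem_undup mem_cat;
    apply/orP; [left; exact: hs|right; exact: ht].
rewrite (@convE f u h _ uw); last by move=> a *; rewrite mem_undup mem_cat hs.
rewrite (@convE g u h _ uw); last first.
  by move=> a *; rewrite mem_undup mem_cat ht ?orbT.
by rewrite -big_split; apply: eq_bigr => a _ /=; rewrite mulrDl.
Qed.

Fact series_mulA : associative series_mul.
Proof.
move=> f g u; apply: coef_inj => h /=.
have [X uX hX] := conv_seq f (series_mul g u) h.
have [E uE hE] := conv_seq (series_mul f g) u h.
pose X' := undup (X ++ fset_set [set a | f a != 0 /\
   sumset [set x | g x != 0] [set x | u x != 0] (h - a)]).
pose E' := undup (E ++ fset_set [set e |
   sumset [set x | f x != 0] [set x | g x != 0] e /\ u (h - e) != 0]).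
have hX' a b c : f a != 0 -> g b != 0 -> u c != 0 -> a + b + c = h -> a \in X'.
  move=> fa gb uc abc; rewrite mem_undup mem_cat; apply/orP; right.
  rewrite in_fset_set.
    apply/mem_set; split => //.
    by exists b => //; exists c => //; rewrite -abc -(addrA a) [RHS]addrC addKr.
  apply: admissible_fiber (coef_admissible f) _.
  exact: admissible_sumset (coef_admissible g) (coef_admissible u).
have hE' a b c : f a != 0 -> g b != 0 -> u c != 0 -> a + b + c = h ->
    a + b \in E'.
  move=> fa gb uc abc; rewrite mem_undup mem_cat; apply/orP; right.
  rewrite in_fset_set.
    apply/mem_set; split => //.
      by exists a => //; exists b.
    by rewrite -abc addrC addKr.
  apply: (@admissible_fiber _ k _ [set x | u x != 0]) (coef_admissible u).
  exact: admissible_sumset (coef_admissible f) (coef_admissible g).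
have uX' : uniq X' by exact: undup_uniq.
have uE' : uniq E' by exact: undup_uniq.
rewrite (@convE _ _ _ X') //; last first.
  by move=> a fa gu; rewrite mem_undup mem_cat hX.
rewrite (@convE _ _ _ E') //; last first.
  by move=> a fa gu; rewrite mem_undup mem_cat hE.
transitivity (\sum_(a <- X') \sum_(e <- E') f a * (g (e - a) * u (h - e))).
  apply: eq_bigr => a _; rewrite -mulr_sumr /=.
  have [->|fa] := eqVneq (f a) 0; first by rewrite !mul0r.
  congr (_ * _).
  rewrite (@convE _ _ _ [seq e - a | e <- E']).
  - by rewrite big_map; apply: eq_bigr => e _; rewrite opprB addrA subrK.
  - by rewrite map_inj_uniq // => x y /addIr.
  - move=> b gb ub; apply/mapP; exists (a + b); last by rewrite addrC addKr.
    by apply: (hE' a b (h - a - b)) => //; rewrite -(addrA h) -opprD [LHS]addrC subrK.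
rewrite exchange_big; apply: eq_bigr => e _ /=.
have [->|ue] := eqVneq (u (h - e)) 0.
  by rewrite mulr0 big1 // => a _; rewrite !mulr0.
rewrite (@convE _ _ _ X') //; last first.
  move=> a fa ga; apply: (hX' a (e - a) (h - e)) => //.
  by rewrite (addrC a) subrK [LHS]addrC subrK.
by rewrite mulr_suml; apply: eq_bigr => a _; rewrite mulrA.
Qed.

Fact series_oner_neq0 : series_one != series_zero.
Proof.
apply/eqP => /(congr1 (fun f : S => f 0)) /=; rewrite eqxx => /eqP.
by rewrite oner_eq0.
Qed.

HB.instance Definition _ := GRing.Zmodule_isComNzRing.Build S
  series_mulA series_mulC series_mul1 series_mulDl series_oner_neq0.

Lemma coef0 x : (0 : S) x = 0. Proof. by []. Qed.
Lemma coefDE (f g : S) x : (f + g) x = f x + g x. Proof. by []. Qed.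
Lemma coefNE f x : (- f) x = - f x. Proof. by []. Qed.
Lemma coef1E x : (1 : S) x = if x == 0 then 1 else 0. Proof. by []. Qed.
Lemma coefME (f g : S) x : (f * g) x = conv f g x. Proof. by []. Qed.
Lemma coef_monoE c g0 (hg : g0 \in Gamma) x :
  mono c hg x = if x == g0 then c else 0. Proof. by []. Qed.
Lemma coef_sumE I (r : seq I) (F : I -> S) x :
  (\sum_(i <- r) F i) x = \sum_(i <- r) F i x.
Proof. by elim/big_rec2: _ => // i y1 y2 _ <-. Qed.

Lemma coef_mono_mul c g0 (hg : g0 \in Gamma) f x :
  (mono c hg * f) x = c * f (x - g0).
Proof.
rewrite coefME (@convE _ _ _ [:: g0]) //=; first by rewrite big_seq1 eqxx.
by move=> a; rewrite inE; case: (a =P _) => //; rewrite eqxx.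
Qed.

Lemma series_neq0 f : f != 0 -> exists g, f g != 0.
Proof.
apply: contra_neqP => /forallNP h; apply: coef_inj => x.
by apply/eqP; apply: contra_notT (h x).
Qed.

End AnyKind.

Lemma seq_min (s : seq R) (x0 : R) : x0 \in s ->
  exists2 m, m \in s & forall x, x \in s -> m <= x.
Proof.
elim: s x0 => // y s IHs x0 _; case: s IHs => [_|z s /(_ z (mem_head _ _))[m ms mP]].
  by exists y; rewrite ?mem_head // => x; rewrite inE => /eqP ->.
have [ym|/ltW my] := leP y m.
  exists y; rewrite ?mem_head // => x; rewrite in_cons => /predU1P[-> //|/mP].
  exact: le_trans.
by exists m; [by rewrite in_cons ms orbT|move=> x; rewrite in_cons => /predU1P[->|/mP]].
Qed.

Section UpwardInverse.
Notation S := (series K Gamma Upward).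
Implicit Types (f u : S).

Lemma up_min f : f != 0 -> exists2 m, f m != 0 & forall g, f g != 0 -> m <= g.
Proof.
move=> /series_neq0[g0 fg0].
have /finite_seqP[s hs] := coef_admissible f (g0 + 1).
have sE g : (g \in s) = (f g != 0) && (g < g0 + 1).
  apply/idP/andP => [gs|[fg gg]].
    by have : [set` s] g by []; rewrite -hs => -[].
  by change ([set` s] g); rewrite -hs; split.
have /seq_min[m] : g0 \in s by rewrite sE fg0 ltrDl /=.
rewrite sE => /andP[fm mg0] mP; exists m => // g fg.
have [gg|] := ltP g (g0 + 1); first by apply: mP; rewrite sE fg.
exact/le_trans/ltW.
Qed.

Definition up_ge (c : R) f := forall g, f g != 0 -> c <= g.

Lemma up_geM a b f u : up_ge a f -> up_ge b u -> up_ge (a + b) (f * u).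
Proof. by move=> fa ub g /conv_supp[x /fa xa [y /ub yb <-]]; exact: lerD. Qed.

Lemma up_geX a f n : up_ge a f -> up_ge (a *+ n) (f ^+ n).
Proof.
move=> fa; elim: n => [|n IHn].
  by rewrite expr0 mulr0n => g; rewrite coef1E; case: (g =P 0) => [->|]; rewrite ?eqxx.
by rewrite exprS mulrS; exact: up_geM.
Qed.

Section Geometric.
Variables (u : S) (delta : R) (delta0 : 0 < delta) (udelta : up_ge delta u).

Let trunc (g : R) : nat := (Num.truncn (g / delta)).+1.

Let trunc_lt (g : R) : g < delta *+ trunc g.
Proof.
rewrite -mulr_natr mulrC -ltr_pdivrMr //; exact: truncnS_gt.
Qed.

Let geo_coef (g : R) : K := (\sum_(n < trunc g) u ^+ n) g.

Let geo_stable (g : R) (N : nat) : g < delta *+ N ->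
  (\sum_(n < N) u ^+ n) g = geo_coef g.
Proof.
rewrite /geo_coef.
suff H (N1 N2 : nat) : g < delta *+ N1 -> (N1 <= N2)%N ->
    (\sum_(n < N2) u ^+ n) g = (\sum_(n < N1) u ^+ n) g.
  move=> gN; case: (leqP N (trunc g)) => h.
    by rewrite -(H _ _ gN h).
  by rewrite (H _ _ (trunc_lt g) (ltnW h)).
move=> gN1 /subnKC <-; rewrite big_split_ord coefDE [X in _ + X]coef_sumE.
rewrite [X in _ + X]big1 ?addr0 // => i _ /=.
apply: contraTeq gN1 => /(up_geX udelta); rewrite -leNgt; apply: le_trans.
by rewrite ler_wpMn2l ?ltW // leq_addr.
Qed.

Let geo_Gamma g : geo_coef g != 0 -> g \in Gamma.
Proof. exact: coef_Gamma. Qed.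

Let geo_admissible : admissible Upward [set g | geo_coef g != 0].
Proof.
move=> C; apply: sub_finite_set (coef_admissible (\sum_(n < trunc C) u ^+ n) C).
move=> g [/= wg gC]; split => //=.
by rewrite geo_stable // (lt_trans gC) // trunc_lt.
Qed.

Definition up_geo : S := Series geo_Gamma geo_admissible.

Lemma up_geoP : (1 - u) * up_geo = 1.
Proof.
apply: coef_inj => h.
pose N := trunc h; set SN : S := \sum_(n < N) u ^+ n.
have -> : ((1 - u) * up_geo) h = ((1 - u) * SN) h.
  rewrite !coefME; apply: eq_fsbigr => a _.
  have [->|ua] := eqVneq ((1 - u) a) 0; first by rewrite !mul0r.
  congr (_ * _); rewrite /= geo_stable //.
  apply: le_lt_trans (trunc_lt h); rewrite gerBl.
  case: (add_supp ua) => [|]; rewrite ?coef1E ?coefNE.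
    by case: (a =P 0) => [->|]; rewrite ?eqxx.
  by rewrite oppr_eq0 => /udelta; apply: le_trans; exact: ltW.
rewrite -opprB mulNr -subrX1 opprB coefDE coefNE.
suff -> : (u ^+ N) h = 0 by rewrite subr0.
apply: contraTeq (trunc_lt h) => /(up_geX udelta); by rewrite -leNgt.
Qed.

End Geometric.
Lemma up_inverse f : f != 0 -> exists u, u * f = 1.
Proof.
move=> f0; have [m fm mP] := up_min f0.
have hm : - m \in Gamma by rewrite rpredN; exact: coef_Gamma fm.
pose p : S := mono (f m)^-1 hm.
have pE x : (p * f) x = (f m)^-1 * f (x + m).
  by rewrite coef_mono_mul opprK.
have supp x : (1 - p * f) x != 0 -> 0 < x.
  rewrite coefDE coefNE pE coef1E; case: (x =P 0) => [->|/eqP x0].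
    by rewrite add0r mulVf // subrr eqxx.
  rewrite sub0r oppr_eq0 mulf_eq0 negb_or => /andP[_ /mP].
  by rewrite lerDr le_eqVlt eq_sym (negbTE x0).
have [d d0 dP] : exists2 d, 0 < d & up_ge d (1 - p * f).
  have [->|/up_min[d /supp d0 dP]] := eqVneq (1 - p * f) 0.
    by exists 1 => // x; rewrite coef0 eqxx.
  by exists d.
exists (up_geo d0 dP * p); rewrite -mulrA mulrC.
by have := up_geoP d0 dP; rewrite subKr.
Qed.

End UpwardInverse.

Section Reflection.
Implicit Types (f : series K Gamma Downward).

Fact reflect_Gamma f g : f (- g) != 0 -> g \in Gamma.
Proof. by move/coef_Gamma; rewrite rpredN. Qed.
Fact reflect_admissible f : admissible Upward [set g | f (- g) != 0].
Proof. exact: admissibleN_down (coef_admissible f). Qed.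
Definition reflect_down f : series K Gamma Upward :=
  Series (@reflect_Gamma f) (reflect_admissible f).

Fact unreflect_Gamma (f : series K Gamma Upward) g :
  f (- g) != 0 -> g \in Gamma.
Proof. by move/coef_Gamma; rewrite rpredN. Qed.
Fact unreflect_admissible (f : series K Gamma Upward) :
  admissible Downward [set g | f (- g) != 0].
Proof. exact: admissibleN_up (coef_admissible f). Qed.
Definition reflect_up (f : series K Gamma Upward) : series K Gamma Downward :=
  Series (@unreflect_Gamma f) (unreflect_admissible f).

Lemma reflect_upM (f1 f2 : series K Gamma Upward) :
  reflect_up (f1 * f2) = reflect_up f1 * reflect_up f2.
Proof.
apply: coef_inj => h.
change (conv f1 f2 (- h) = conv (reflect_up f1) (reflect_up f2) h).
have [s us hs] := conv_seq f1 f2 (- h).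
rewrite (convE us hs) (@convE _ _ _ _ [seq - a | a <- s]).
- rewrite big_map; apply: eq_bigr => a _ /=.
  by rewrite !opprK opprD.
- by rewrite map_inj_uniq //; exact: oppr_inj.
- move=> a /= f1a f2a; apply/mapP; exists (- a); last by rewrite opprK.
  by apply: hs => //; rewrite -opprD.
Qed.

Lemma down_inverse f : f != 0 -> exists u, u * f = 1.
Proof.
move=> f0.
have fK : reflect_up (reflect_down f) = f.
  by apply: coef_inj => x /=; rewrite opprK.
have /up_inverse[u uf] : reflect_down f != 0.
  apply: contra_neq f0 => rf0; rewrite -fK rf0.
  by apply: coef_inj.
exists (reflect_up u); rewrite -[f]fK -reflect_upM uf.
by apply: coef_inj => x; rewrite /= oppr_eq0.
Qed.

End Reflection.

Section Embedding.

Fact embed_admissible k (f : series K Gamma Finite) :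
  admissible k [set g | f g != 0].
Proof. exact: finite_admissible (coef_admissible f). Qed.
Definition embed k (f : series K Gamma Finite) : series K Gamma k :=
  Series (@coef_Gamma _ _ _ _ f) (embed_admissible k f).

Fact embed_zmod_morphism k : zmod_morphism (embed k).
Proof. by move=> f1 f2; exact: coef_inj. Qed.
Fact embed_monoid_morphism k : monoid_morphism (embed k).
Proof. by split=> [|f1 f2]; exact: coef_inj. Qed.

Lemma embed_inj k : injective (embed k).
Proof.
by move=> f1 f2 e; apply: coef_inj => x; have := congr1 (fun f => coef f x) e.
Qed.

End Embedding.
End SeriesRing.

Definition group_algebra (R : realType) (K : fieldType) (Gamma : zmodClosed R) :=
  series K Gamma Finite.
Definition novikov_up (R : realType) (K : fieldType) (Gamma : zmodClosed R) :=
  series K Gamma Upward.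
Definition novikov_down (R : realType) (K : fieldType) (Gamma : zmodClosed R) :=
  series K Gamma Downward.

Section Novikov.
Context (R : realType) (K : fieldType) (Gamma : zmodClosed R).
Local Notation L := (group_algebra K Gamma).
Local Notation Lup := (novikov_up K Gamma).
Local Notation Ldn := (novikov_down K Gamma).

HB.instance Definition _ := GRing.ComNzRing.on L.
HB.instance Definition _ := GRing.ComNzRing.on Lup.
HB.instance Definition _ := GRing.ComNzRing.on Ldn.

Definition up_inv (f : Lup) : Lup := xget 0 [set u | u * f = 1].
Fact up_mulVf (f : Lup) : f != 0 -> up_inv f * f = 1.
Proof. by move=> /up_inverse; exact: xgetPex. Qed.
Fact up_inv0 : up_inv 0 = 0.
Proof.
rewrite /up_inv; case: xgetP => // u _ /=; rewrite mulr0 => /eqP.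
by rewrite eq_sym oner_eq0.
Qed.
HB.instance Definition _ := GRing.ComNzRing_isField.Build Lup up_mulVf up_inv0.

Definition down_inv (f : Ldn) : Ldn := xget 0 [set u | u * f = 1].
Fact down_mulVf (f : Ldn) : f != 0 -> down_inv f * f = 1.
Proof. by move=> /down_inverse; exact: xgetPex. Qed.
Fact down_inv0 : down_inv 0 = 0.
Proof.
rewrite /down_inv; case: xgetP => // u _ /=; rewrite mulr0 => /eqP.
by rewrite eq_sym oner_eq0.
Qed.
HB.instance Definition _ :=
  GRing.ComNzRing_isField.Build Ldn down_mulVf down_inv0.

Definition to_up (f : L) : Lup := embed Upward f.
Definition to_down (f : L) : Ldn := embed Downward f.

HB.instance Definition _ :=
  GRing.isZmodMorphism.Build L Lup to_up (@embed_zmod_morphism _ _ _ Upward).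
HB.instance Definition _ :=
  GRing.isMonoidMorphism.Build L Lup to_up (@embed_monoid_morphism _ _ _ Upward).
HB.instance Definition _ :=
  GRing.isZmodMorphism.Build L Ldn to_down (@embed_zmod_morphism _ _ _ Downward).
HB.instance Definition _ :=
  GRing.isMonoidMorphism.Build L Ldn to_down
    (@embed_monoid_morphism _ _ _ Downward).

Definition alg_unit : pred L := fun f => `[< exists u, u * f = 1 >].
Definition alg_inv (f : L) : L := xget f [set u | u * f = 1].
Fact alg_mulVf : {in alg_unit, left_inverse 1 alg_inv *%R}.
Proof.
by move=> f /asboolP; exact: xgetPex.
Qed.
Fact alg_unitPl (f g : L) : g * f = 1 -> alg_unit f.
Proof. by move=> gf; apply/asboolP; exists g. Qed.
Fact alg_inv_out : {in [predC alg_unit], alg_inv =1 id}.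
Proof.
move=> f; rewrite !inE => /asboolP nf.
by rewrite /alg_inv; case: xgetP => // u _ uf; case: nf; exists u.
Qed.
HB.instance Definition _ :=
  GRing.ComNzRing_hasMulInverse.Build L alg_mulVf alg_unitPl alg_inv_out.

Fact alg_integral (f g : L) : f * g = 0 -> (f == 0) || (g == 0).
Proof.
move=> /(congr1 to_up) /eqP; rewrite rmorphM rmorph0 mulf_eq0.
by case/orP => /eqP e; apply/orP; [left|right]; apply/eqP;
  apply: (@embed_inj _ _ _ Upward); rewrite [LHS]e; exact: coef_inj.
Qed.
HB.instance Definition _ := GRing.ComUnitRing_isIntegral.Build L alg_integral.

(* Supports of nonzero series attain these bounds, see [nu_upP] and
   [nu_downP]; on 0 the conventions for set0 give +oo and -oo respectively. *)
Definition nu_up (f : Lup) : \bar R :=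
  ereal_inf [set g%:E | g in [set g : R | f g != 0]].
Definition nu_down (f : Ldn) : \bar R :=
  ereal_sup [set g%:E | g in [set g : R | f g != 0]].

Lemma nu_up0 : nu_up 0 = +oo%E.
Proof.
rewrite /nu_up (_ : [set g : R | _] = set0) ?image_set0 ?ereal_inf0 //.
by apply/seteqP; split => // g /=; rewrite eqxx.
Qed.

Lemma nu_down0 : nu_down 0 = -oo%E.
Proof.
rewrite /nu_down (_ : [set g : R | _] = set0) ?image_set0 ?ereal_sup0 //.
by apply/seteqP; split => // g /=; rewrite eqxx.
Qed.

Lemma nu_upP (f : Lup) : f != 0 ->
  exists m, [/\ nu_up f = m%:E, f m != 0 & forall g, f g != 0 -> m <= g].
Proof.
move=> /up_min[m fm mP]; exists m; split => //.
apply/le_anti/andP; split; first by apply: ereal_inf_lbound; exists m.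
by apply: le_ereal_inf_tmp => _ [g fg <-]; rewrite lee_fin mP.
Qed.

Lemma nu_downP (f : Ldn) : f != 0 ->
  exists m, [/\ nu_down f = m%:E, f m != 0 & forall g, f g != 0 -> g <= m].
Proof.
move=> f0; have /up_min[m fm mP] : reflect_down f != 0.
  apply: contra_neq f0 => rf0; apply: coef_inj => x.
  by have := congr1 (fun u => coef u (- x)) rf0; rewrite /= opprK.
have mP' g : f g != 0 -> g <= - m.
  by move=> fg; rewrite lerNr mP //= opprK.
exists (- m); split => //.
apply/le_anti/andP; split; last by apply: ereal_sup_ubound; exists (- m).
by apply: ge_ereal_sup => _ [g fg <-]; rewrite lee_fin mP'.
Qed.

End Novikov.

Section Modules.
Variables (A : nzRingType) (M : lmodType A).

Definition lin_indep n (x : 'I_n -> M) : Prop :=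
  forall c : 'I_n -> A, \sum_i c i *: x i = 0 -> forall i, c i = 0.

Definition lin_spans n (x : 'I_n -> M) : Prop :=
  forall y, exists c : 'I_n -> A, y = \sum_i c i *: x i.

Definition lin_basis n (x : 'I_n -> M) : Prop := lin_indep x /\ lin_spans x.

Definition finitely_generated : Prop :=
  exists n, exists x : 'I_n -> M, lin_spans x.

End Modules.

Definition has_dim (F : fieldType) (V : lmodType F) (d : nat) : Prop :=
  exists e : 'I_d -> V, lin_basis e.

Section TorsionQuotient.
Variables (A : idomainType) (M : lmodType A).

Definition torsion (x : M) : bool := `[< exists2 a : A, a != 0 & a *: x = 0 >].

Fact torsion_zmod_closed : zmod_closed torsion.
Proof.
split=> [|x y /asboolP[a a0 ax] /asboolP[b b0 bY]]; apply/asboolP.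
  by exists 1; rewrite ?oner_eq0 // scaler0.
exists (a * b); first by rewrite mulf_neq0.
by rewrite scalerBr {1}mulrC -!scalerA ax bY !scaler0 subrr.
Qed.
HB.instance Definition _ := GRing.isZmodClosed.Build M torsion torsion_zmod_closed.

Definition torsion_pred : zmodClosed M := GRing.ZmodClosed.clone M torsion _.

Lemma torsionZ a x : x \in torsion -> a *: x \in torsion.
Proof.
move=> /asboolP[b b0 bx]; apply/asboolP; exists b => //.
by rewrite scalerA mulrC -scalerA bx scaler0.
Qed.

Definition mod_torsion := Quotient.quot torsion_pred.
HB.instance Definition _ := GRing.Zmodule.on mod_torsion.

Definition to_mod_torsion (x : M) : mod_torsion := \pi_(Quotient.quot torsion_pred)%qT x.

Lemma to_mod_torsion_eq x y :
  (to_mod_torsion x == to_mod_torsion y) = (x - y \in torsion).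
Proof. by rewrite Quotient.idealrBE. Qed.

Fact to_mod_torsion_zmod : zmod_morphism to_mod_torsion.
Proof. exact: (raddfB (\pi_(Quotient.quot torsion_pred)%qT)). Qed.
HB.instance Definition _ :=
  GRing.isZmodMorphism.Build M mod_torsion to_mod_torsion to_mod_torsion_zmod.

Definition mod_torsion_scale (a : A) (q : mod_torsion) : mod_torsion :=
  to_mod_torsion (a *: repr q).

Lemma mod_torsion_scaleE a x :
  mod_torsion_scale a (to_mod_torsion x) = to_mod_torsion (a *: x).
Proof.
apply/eqP; rewrite to_mod_torsion_eq -scalerBr torsionZ //.
by rewrite -to_mod_torsion_eq /to_mod_torsion reprK.
Qed.

Lemma mod_torsionW (P : mod_torsion -> Prop) :
  (forall x, P (to_mod_torsion x)) -> forall q, P q.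
Proof. by move=> h; elim/quotW; exact: h. Qed.

Fact mod_torsion_scaleA a b q :
  mod_torsion_scale a (mod_torsion_scale b q) = mod_torsion_scale (a * b) q.
Proof. by elim/mod_torsionW: q => x; rewrite !mod_torsion_scaleE scalerA. Qed.
Fact mod_torsion_scale1 : left_id 1 mod_torsion_scale.
Proof. by elim/mod_torsionW => x; rewrite mod_torsion_scaleE scale1r. Qed.
Fact mod_torsion_scaleDr : right_distributive mod_torsion_scale +%R.
Proof.
move=> a; elim/mod_torsionW => x; elim/mod_torsionW => y.
by rewrite -raddfD !mod_torsion_scaleE scalerDr raddfD.
Qed.
Fact mod_torsion_scaleDl q : {morph mod_torsion_scale^~ q : a b / a + b}.
Proof.
by move=> a b; elim/mod_torsionW: q => x; rewrite !mod_torsion_scaleE scalerDl raddfD.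
Qed.
HB.instance Definition _ := GRing.Zmodule_isLmodule.Build A mod_torsion
  mod_torsion_scaleA mod_torsion_scale1 mod_torsion_scaleDr mod_torsion_scaleDl.

End TorsionQuotient.

(* The extension of scalars B (x)_A M along iota : A -> B: finite formal sums
   of pure tensors b (x) m, given as lists of pairs, modulo the congruence
   generated by the bilinearity relations. *)
Section ScalarExtension.
Variables (A B : comNzRingType) (iota : {rmorphism A -> B}) (M : lmodType A).

Inductive tensor_rel : seq (B * M) -> seq (B * M) -> Prop :=
| tensor_refl s : tensor_rel s s
| tensor_sym s t : tensor_rel s t -> tensor_rel t s
| tensor_trans s t u : tensor_rel s t -> tensor_rel t u -> tensor_rel s u
| tensor_cat s t s' t' : tensor_rel s t -> tensor_rel s' t' ->
    tensor_rel (s ++ s') (t ++ t')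
| tensor_catC s t : tensor_rel (s ++ t) (t ++ s)
| tensor_zero m : tensor_rel [:: (0, m)] [::]
| tensor_addl b b' m : tensor_rel [:: (b + b', m)] [:: (b, m); (b', m)]
| tensor_addr b m m' : tensor_rel [:: (b, m + m')] [:: (b, m); (b, m')]
| tensor_balanced b a m : tensor_rel [:: (b * iota a, m)] [:: (b, a *: m)].

Definition tensor_relb (s t : seq (B * M)) : bool := `[< tensor_rel s t >].

Fact tensor_relb_equiv : equiv_class_of tensor_relb.
Proof.
split=> [s|s t|s t u]; first exact/asboolP/tensor_refl.
  by apply/asboolP/asboolP; exact: tensor_sym.
by move=> /asboolP h1 /asboolP h2; apply/asboolP; exact: tensor_trans h1 h2.
Qed.
Canonical tensor_relb_equiv_rel := EquivRelPack tensor_relb_equiv.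
Canonical tensor_relb_encModRel := defaultEncModRel tensor_relb.

Definition scalar_ext := {eq_quot tensor_relb}%qT.
HB.instance Definition _ := Choice.on scalar_ext.
HB.instance Definition _ := EqQuotient.on scalar_ext.

Definition tensor_class (s : seq (B * M)) : scalar_ext := \pi_scalar_ext%qT s.
(* the pure tensor b (x) m *)
Definition tensor (b : B) (m : M) : scalar_ext := tensor_class [:: (b, m)].

Lemma tensor_classP s t : tensor_class s = tensor_class t <-> tensor_rel s t.
Proof.
split=> [/eqmodP/asboolP //|h]; apply/eqmodP/asboolP; exact: h.
Qed.

Lemma tensor_classW (P : scalar_ext -> Prop) :
  (forall s, P (tensor_class s)) -> forall x, P x.
Proof. by move=> h; elim/quotW; exact: h. Qed.

Lemma tensor_rel_repr s : tensor_rel (repr (tensor_class s)) s.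
Proof. by apply/tensor_classP; rewrite /tensor_class reprK. Qed.

Let scale_seq (b : B) (s : seq (B * M)) := [seq (b * p.1, p.2) | p <- s].

Let scale_rel b s t : tensor_rel s t -> tensor_rel (scale_seq b s) (scale_seq b t).
Proof.
elim=> {s t} /=.
- by move=> s; exact: tensor_refl.
- by move=> s t _; exact: tensor_sym.
- by move=> s t u _ h1 _; exact: tensor_trans.
- by move=> s t s' t' _ h1 _ h2; rewrite /scale_seq !map_cat; exact: tensor_cat.
- by move=> s t; rewrite /scale_seq !map_cat; exact: tensor_catC.
- by move=> m; rewrite mulr0; exact: tensor_zero.
- by move=> c c' m; rewrite mulrDr; exact: tensor_addl.
- by move=> c m m'; exact: tensor_addr.
- by move=> c a m; rewrite mulrA; exact: tensor_balanced.
Qed.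

Definition ext_zero : scalar_ext := tensor_class [::].
Definition ext_add (x y : scalar_ext) : scalar_ext :=
  tensor_class (repr x ++ repr y).
Definition ext_scale (b : B) (x : scalar_ext) : scalar_ext :=
  tensor_class [seq (b * p.1, p.2) | p <- repr x].
Definition ext_opp (x : scalar_ext) : scalar_ext := ext_scale (-1) x.

Lemma ext_addE s t :
  ext_add (tensor_class s) (tensor_class t) = tensor_class (s ++ t).
Proof. by apply/tensor_classP/tensor_cat; exact: tensor_rel_repr. Qed.

Lemma ext_scaleE b s :
  ext_scale b (tensor_class s) = tensor_class [seq (b * p.1, p.2) | p <- s].
Proof. by apply/tensor_classP/scale_rel; exact: tensor_rel_repr. Qed.

Fact ext_addA : associative ext_add.
Proof.
elim/tensor_classW => s; elim/tensor_classW => t; elim/tensor_classW => u.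
by rewrite !ext_addE catA.
Qed.
Fact ext_addC : commutative ext_add.
Proof.
elim/tensor_classW => s; elim/tensor_classW => t.
by rewrite !ext_addE; exact/tensor_classP/tensor_catC.
Qed.
Fact ext_add0 : left_id ext_zero ext_add.
Proof. by elim/tensor_classW => s; rewrite ext_addE. Qed.

Let ext_scaleDl_aux b b' s : tensor_rel (scale_seq (b + b') s)
  (scale_seq b s ++ scale_seq b' s).
Proof.
elim: s => [|[c m] s IHs] /=; first exact: tensor_refl.
rewrite -cat1s -[X in tensor_rel _ X]cat1s.
apply: tensor_trans (tensor_cat (tensor_refl [:: _]) IHs) _.
rewrite mulrDl.
apply: tensor_trans (tensor_cat (tensor_addl _ _ _) (tensor_refl _)) _.
rewrite -cat1s -catA; apply: tensor_cat; first exact: tensor_refl.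
rewrite -[X in tensor_rel _ (_ ++ X)]cat1s !catA.
by apply: tensor_cat; [exact: tensor_catC|exact: tensor_refl].
Qed.

Let scale0_rel s : tensor_rel (scale_seq 0 s) [::].
Proof.
elim: s => [|[c m] s IHs] /=; first exact: tensor_refl.
rewrite mul0r -cat1s -[[::]](cats0 [::]).
by apply: tensor_cat => //; exact: tensor_zero.
Qed.

Fact ext_scaleDl x : {morph ext_scale^~ x : b b' / b + b' >-> ext_add b b'}.
Proof.
move=> b b'; elim/tensor_classW: x => s.
by rewrite !ext_scaleE ext_addE; exact/tensor_classP/ext_scaleDl_aux.
Qed.
Fact ext_scale1 : left_id 1 ext_scale.
Proof.
elim/tensor_classW => s; rewrite ext_scaleE; congr tensor_class.
by rewrite -[RHS]map_id; apply: eq_map => -[c m]; rewrite /= mul1r.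
Qed.
Fact ext_addN : left_inverse ext_zero ext_opp ext_add.
Proof.
elim/tensor_classW => s; rewrite -[X in ext_add _ X]ext_scale1.
rewrite -ext_scaleDl addNr ext_scaleE.
exact/tensor_classP/scale0_rel.
Qed.
HB.instance Definition _ :=
  GRing.isZmodule.Build scalar_ext ext_addA ext_addC ext_add0 ext_addN.

Fact ext_scaleA b c x : ext_scale b (ext_scale c x) = ext_scale (b * c) x.
Proof.
elim/tensor_classW: x => s; rewrite !ext_scaleE -map_comp.
by congr tensor_class; apply: eq_map => -[d m]; rewrite /= mulrA.
Qed.
Fact ext_scaleDr : right_distributive ext_scale +%R.
Proof.
move=> b; elim/tensor_classW => s; elim/tensor_classW => t.
by rewrite [_ + _]ext_addE !ext_scaleE [_ + _]ext_addE map_cat.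
Qed.
HB.instance Definition _ := GRing.Zmodule_isLmodule.Build B scalar_ext
  ext_scaleA ext_scale1 ext_scaleDr ext_scaleDl.

Section Induced.
Variables (V : lmodType B) (phi : {linear M -> V | iota \; *:%R}).

(* the map 1 (x) phi : b (x) m |-> b *: phi m *)
Definition ext_map (x : scalar_ext) : V := \sum_(p <- repr x) p.1 *: phi p.2.

Lemma ext_mapE s : ext_map (tensor_class s) = \sum_(p <- s) p.1 *: phi p.2.
Proof.
rewrite /ext_map; move: (tensor_rel_repr s); move: (repr _) => t.
elim=> {s t} //=.
- by move=> s t u _ -> _ ->.
- by move=> s t s' t' _ + _; rewrite !big_cat => -> ->.
- by move=> s t; rewrite !big_cat /= addrC.
- by move=> m; rewrite big_seq1 big_nil scale0r.
- by move=> b b' m; rewrite !big_cons !big_nil /= !addr0 scalerDl.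
- by move=> b m m'; rewrite !big_cons !big_nil /= !addr0 raddfD scalerDr.
- by move=> b a m; rewrite !big_seq1 /= linearZ /= scalerA.
Qed.

Lemma ext_map_tensor b m : ext_map (tensor b m) = b *: phi m.
Proof. by rewrite ext_mapE big_seq1. Qed.

Fact ext_map_linear : linear ext_map.
Proof.
move=> b; elim/tensor_classW => s; elim/tensor_classW => t.
rewrite [b *: _]ext_scaleE [_ + _]ext_addE !ext_mapE big_cat big_map scaler_sumr.
by congr (_ + _); apply: eq_bigr => p _; rewrite scalerA.
Qed.
HB.instance Definition _ :=
  GRing.isLinear.Build B scalar_ext V *:%R ext_map ext_map_linear.

End Induced.
End ScalarExtension.

Definition fg_subgroup (R : realType) (Gamma : zmodClosed R) : Prop :=
  exists n, exists s : n.-tuple R, forall x, x \in Gamma <-> inIntSpan s x.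

Definition discrete_subgroup (R : realType) (Gamma : zmodClosed R) : Prop :=
  forall x, x \in Gamma -> isolated [set y : R | y \in Gamma] x.

Definition mod_subgroup (R : realType) (Gamma : zmodClosed R) (x : R) :
  Quotient.quot Gamma := \pi_(Quotient.quot Gamma)%qT x.

Section NormedSpaces.
Context {R : realType} {K : fieldType} {Gamma : zmodClosed R}.
Local Notation Lup := (novikov_up K Gamma).
Local Notation Ldn := (novikov_down K Gamma).
Local Open Scope ereal_scope.

Record up_norm (V : vectType Lup) := UpNorm {
  up_rho :> V -> \bar R ;
  up_rho_npinfty : forall x, up_rho x != +oo ;
  up_rho_eqNy : forall x, up_rho x = -oo <-> x = 0%R ;
  up_rhoZ : forall (a : Lup) x, up_rho (a *: x)%R = up_rho x - nu_up a ;
  up_rhoD : forall x y, up_rho (x + y)%R <= maxe (up_rho x) (up_rho y)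
}.

Record down_norm (V : vectType Ldn) := DownNorm {
  down_rho :> V -> \bar R ;
  down_rho_nninfty : forall x, down_rho x != -oo ;
  down_rho_eqy : forall x, down_rho x = +oo <-> x = 0%R ;
  down_rhoZ : forall (a : Ldn) x, down_rho (a *: x)%R = down_rho x - nu_down a ;
  down_rhoD : forall x y, mine (down_rho x) (down_rho y) <= down_rho (x + y)%R
}.

Definition up_orthogonal (V : vectType Lup) (rho : up_norm V) n
    (x : 'I_n -> V) : Prop :=
  forall a : 'I_n -> Lup, rho (\sum_i a i *: x i)%R =
    \big[maxe/-oo]_i (rho (x i) - nu_up (a i)).

Definition down_orthogonal (V : vectType Ldn) (rho : down_norm V) n
    (x : 'I_n -> V) : Prop :=
  forall a : 'I_n -> Ldn, rho (\sum_i a i *: x i)%R =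
    \big[mine/+oo]_i (rho (x i) - nu_down (a i)).

(* suprema over the nonzero vectors; -oo on the zero space *)
Definition up_dist (V : vectType Lup) (rho rho' : up_norm V) : \bar R :=
  ereal_sup [set `|rho x - rho' x| | x in [set x : V | x != 0%R]].
Definition down_dist (V : vectType Ldn) (rho rho' : down_norm V) : \bar R :=
  ereal_sup [set `|rho x - rho' x| | x in [set x : V | x != 0%R]].

End NormedSpaces.

Record matched_pair (R : realType) (K : fieldType) (Gamma : zmodClosed R) :=
  MatchedPair {
    mp_H : lmodType (group_algebra K Gamma) ;
    mp_up : vectType (novikov_up K Gamma) ;
    mp_down : vectType (novikov_down K Gamma) ;
    phi_up : {linear mp_H -> mp_up | @to_up R K Gamma \; *:%R} ;
    phi_down : {linear mp_H -> mp_down | @to_down R K Gamma \; *:%R} ;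
    mp_H_fg : finitely_generated mp_H ;
    phi_up_iso : bijective (ext_map phi_up) ;
    phi_down_iso : bijective (ext_map phi_down)
  }.

Record filtered_matched_pair (R : realType) (K : fieldType)
    (Gamma : zmodClosed R) := FilteredMatchedPair {
  fmp_base :> matched_pair K Gamma ;
  fmp_rho_up : up_norm (mp_up fmp_base) ;
  fmp_rho_down : down_norm (mp_down fmp_base)
}.

(* dim_Q(L) (Q(L) (x)_L H) = d, where L is the group algebra *)
Definition has_rank (R : realType) (K : fieldType) (Gamma : zmodClosed R)
    (H : lmodType (group_algebra K Gamma)) (d : nat) : Prop :=
  has_dim (scalar_ext (@FracField.tofrac (group_algebra K Gamma)) H) d.

Section Invariants.
Context {R : realType} {K : fieldType} {Gamma : zmodClosed R}.
Variable P : filtered_matched_pair K Gamma.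
Local Notation H := (mp_H P).
Local Notation rho_up x := (fmp_rho_up P (phi_up P x)).
Local Notation rho_down x := (fmp_rho_down P (phi_down P x)).

Definition gap (i : nat) : \bar R :=
  ereal_sup [set gamma%:E | gamma in [set gamma : R |
    exists x : 'I_i -> H, lin_indep x /\
      forall j, (gamma%:E <= rho_down (x j) - rho_up (x j))%E]].

Definition doubly_orthogonal_basis d (e : 'I_d -> H) : Prop :=
  [/\ lin_basis (fun i => to_mod_torsion (e i)),
      basis_of fullv [tuple phi_up P (e i) | i < d] &
      basis_of fullv [tuple phi_down P (e i) | i < d]] /\
  up_orthogonal (fmp_rho_up P) (fun i => phi_up P (e i)) /\
  down_orthogonal (fmp_rho_down P) (fun i => phi_down P (e i)).

Definition spectrum_point (x : H) : Quotient.quot Gamma * R :=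
  (mod_subgroup Gamma (fine (rho_up x)), fine (rho_down x) - fine (rho_up x)).

Definition is_basis_spectrum d (S : {mset (Quotient.quot Gamma * R)%type}%mset) : Prop :=
  exists2 e : 'I_d -> H, doubly_orthogonal_basis e &
    S = seq_mset [seq spectrum_point (e i) | i <- enum 'I_d].

End Invariants.

(* the elements of a multiset counted with multiplicity, so that a bijection of
   multisets is a bijection between these types *)
Definition mset_elt (T : choiceType) (S : {mset T}%mset) : Type :=
  {p : T * nat | (p.2 < S p.1)%N}.
Definition mset_val (T : choiceType) (S : {mset T}%mset) (x : mset_elt S) : T :=
  (sval x).1.

(* Main.v *)
Require Import Defs.
From HB Require Import structures.
From mathcomp Require Import all_boot all_order all_algebra.
From mathcomp Require Import finmap multiset.
From mathcomp Require Import all_classical all_reals all_analysis.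
From mathcomp Require Import ring_quotient.
From mathcomp Require Import lra.
Import Order.TTheory GRing.Theory Num.Theory.
Import numFieldNormedType.Exports.

Set Implicit Arguments.
Unset Strict Implicit.
Unset Printing Implicit Defensive.

Local Open Scope classical_set_scope.
Local Open Scope ring_scope.

(** The two sides are treated symmetrically. Put n1 = rho_up, w1 = nu_up and
    n2 = - rho_down, w2 = - nu_down: both norms are then non-Archimedean norms over a
    complete valued field, in the same sense, and w1 a + w2 a <= 0 for every nonzero a
    of the group algebra. The height n1 + n2 of an element of H is the opposite of the
    length that enters the gaps.

    Gaps. A change of the norms by at most t changes every height by at most 2 t, hence
    every gap by at most 2 t as soon as the gaps are finite. Finiteness is the point:
    the height is bounded below on the non-torsion elements ([height_bounded_below]),
    because over a complete field the norm of a combination of independent vectors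
    controls its coefficients ([norm_controls_coef]), and the two orders of a
    coefficient cannot both be large.

    Existence of doubly-orthogonal bases. When Gamma is discrete, the norms take values
    in finitely many cosets of Gamma ([finite_cosets]), so that the height attains its
    minimum on every nonempty set of non-torsion elements. Choose e_0, e_1, ...
    successively, each of minimal height among the elements rationally independent of
    the previous ones. A failure of orthogonality on either side, or of generation of
    H modulo torsion, produces an element of H independent of e_0, ..., e_(m-1) whose
    height is less than that of e_m: see [greedy_orthogonal] and [greedy_spans].

    Stability of the spectrum. Let C be the matrix expressing one doubly-orthogonal
    basis in terms of the other, and D its inverse. If the entries C j i and D i' j are
    nonzero, orthogonality bounds the pairs of norms (n1, n2) of e_i, e'_j and e_i', up
    to t and to translation by Gamma, in such a way that, when e_i' has a height not
    less than that of e_i, the pair of e'_j is within t of that of e_i or of that of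
    e_i'. Therefore, for a set S of indices, the part of D C factoring through the
    indices matched with S is unitriangular for the order by height, so that at least
    #|S| indices are matched with S ([matching_of_inverse]), and Hall's marriage theorem
    gives the bijection ([spectra_matching]). *)

(** * Independence and rational spans *)

Section Independence.
Variables (A : nzRingType) (M : lmodType A).
Implicit Types (h : nat -> M) (x : M) (k n m : nat).

(** Finite families are kept as sequences h : nat -> M of which only the first n
    terms matter, so that prefixes and one-step extensions need no reindexing;
    [indep h n] is the linear independence of h 0, ..., h (n - 1), and
    [in_span h n x] says that x is one of their linear combinations. *)
Definition indep h n : Prop :=
  forall c : nat -> A, \sum_(i < n) c i *: h i = 0 -> forall i, (i < n)%N -> c i = 0.

Definition in_span h n x : Prop := exists c : nat -> A, x = \sum_(i < n) c i *: h i.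

(** membership in the span over the fraction field, with denominators cleared *)
Definition in_rat_span h n x : Prop :=
  exists2 a : A, a != 0 & in_span h n (a *: x).

(** the sequence that continues a family indexed by 'I_n by zero *)
Definition extend (T : nmodType) n (f : 'I_n -> T) (i : nat) : T :=
  if insub i is Some j then f j else 0.

Lemma extendE (T : nmodType) n (f : 'I_n -> T) (i : 'I_n) : extend f i = f i.
Proof. by rewrite /extend valK. Qed.

Lemma indepP h n : indep h n <-> lin_indep (fun i : 'I_n => h i).
Proof.
split=> [hi c cs i|hi c cs i lti]; last exact: (hi (fun i : 'I_n => c i) cs (Ordinal lti)).
rewrite -(extendE c); apply: hi => //.
by rewrite -[RHS]cs; apply: eq_bigr => j _; rewrite extendE.
Qed.

Lemma in_spanP h n x :
  in_span h n x <-> exists c : 'I_n -> A, x = \sum_i c i *: h i.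
Proof.
split=> [[c ->]|[c ->]]; first by exists (fun i : 'I_n => c i).
by exists (extend c); apply: eq_bigr => j _; rewrite extendE.
Qed.

Lemma sum_indicator h n i (a : A) : (i < n)%N ->
  \sum_(j < n) (if (j : nat) == i then a else 0) *: h j = a *: h i.
Proof.
move=> lti; rewrite (bigD1 (Ordinal lti)) //= eqxx big1 ?addr0 //.
by move=> j /negbTE; rewrite -val_eqE /= => ->; rewrite scale0r.
Qed.

Lemma widen_sum h n m (c : nat -> A) : (n <= m)%N ->
  \sum_(i < n) c i *: h i = \sum_(i < m) (if (i < n)%N then c i else 0) *: h i.
Proof.
move=> nm; rewrite (big_ord_widen m (fun i => c i *: h i) nm) big_mkcond.
by apply: eq_bigr => i _; case: ifP; rewrite ?scale0r.
Qed.

Lemma indep_prefix h n m : (n <= m)%N -> indep h m -> indep h n.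
Proof.
move=> nm hm c cs i lti.
have := hm (fun i => if (i < n)%N then c i else 0).
by rewrite -widen_sum // => /(_ cs i (leq_trans lti nm)); rewrite lti.
Qed.

Lemma indep_coef h n (c c' : nat -> A) : indep h n ->
  \sum_(i < n) c i *: h i = \sum_(i < n) c' i *: h i ->
  forall i, (i < n)%N -> c i = c' i.
Proof.
move=> hn e i lti; apply/eqP; rewrite -subr_eq0; apply/eqP.
apply: (hn (fun i => c i - c' i)) => //.
by under eq_bigr do rewrite scalerBl; rewrite sumrB e subrr.
Qed.

Lemma indep_notin_rat_span h n i : indep h n -> (i < n)%N ->
  ~ in_rat_span h i (h i).
Proof.
move=> hn lti [a a0 [c e]]; move/eqP: a0; apply.
rewrite (widen_sum _ _ (ltnW lti)) -(@sum_indicator h n) // in e.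
have := @indep_coef h n (fun j => if j == i then a else 0)
  (fun j => if (j < i)%N then c j else 0) hn e i lti.
by rewrite eqxx ltnn.
Qed.

Lemma indep_eq h h' n : (forall i, (i < n)%N -> h i = h' i) -> indep h n -> indep h' n.
Proof.
move=> e hn c cs; apply: hn; rewrite -[RHS]cs; apply: eq_bigr => i _.
by rewrite e.
Qed.

Lemma in_span_eq h h' n x :
  (forall i, (i < n)%N -> h i = h' i) -> in_span h n x -> in_span h' n x.
Proof. by move=> e [c ->]; exists c; apply: eq_bigr => i _; rewrite e. Qed.

Lemma in_span_widen h n m x : (n <= m)%N -> in_span h n x -> in_span h m x.
Proof.
by move=> nm [c ->]; exists (fun i => if (i < n)%N then c i else 0); rewrite -widen_sum.
Qed.

Lemma in_span_mem h n i : (i < n)%N -> in_span h n (h i).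
Proof.
move=> lti; exists (fun j => if j == i then 1 else 0).
by rewrite sum_indicator // scale1r.
Qed.

End Independence.

Section CommutativeSpan.
Variables (A : comNzRingType) (M : lmodType A).

Lemma in_spanZ (h : nat -> M) n x a : in_span h n x -> in_span h n (a *: x).
Proof.
move=> [c ->]; exists (fun i => a * c i).
by rewrite scaler_sumr; apply: eq_bigr => i _; rewrite scalerA.
Qed.

Lemma in_spanD (h : nat -> M) n x y :
  in_span h n x -> in_span h n y -> in_span h n (x + y).
Proof.
move=> [c ->] [c' ->]; exists (fun i => c i + c' i).
by rewrite -big_split; apply: eq_bigr => i _; rewrite scalerDl.
Qed.

Lemma in_span_sum (I : finType) (h : nat -> M) n (F : I -> M) :
  (forall i, in_span h n (F i)) -> in_span h n (\sum_i F i).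
Proof.
move=> hF; elim/big_ind: _ => //; last exact: in_spanD.
by exists (fun=> 0); rewrite big1 // => i _; rewrite scale0r.
Qed.

End CommutativeSpan.

Section RationalSpan.
Variables (A : idomainType) (M : lmodType A).
Implicit Types (h : nat -> M) (x : M).

Lemma indepS h n : indep h n -> ~ in_rat_span h n (h n) -> indep h n.+1.
Proof.
move=> hn nsp c; rewrite big_ord_recr /= => cs.
have cn0 : c n = 0.
  apply: contra_notP nsp => /eqP cn0; exists (- c n); rewrite ?oppr_eq0 //.
  by exists c; apply/eqP; rewrite scaleNr eqr_oppLR -addr_eq0 addrC cs.
move: cs; rewrite cn0 scale0r addr0 => cs i; rewrite ltnS leq_eqVlt.
by case/predU1P => [->//|]; exact: hn cs i.
Qed.

Lemma nontorsion_of_notin_rat_span h n x :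
  ~ in_rat_span h n x -> x \notin @torsion A M.
Proof.
move=> nx; apply/negP => /asboolP[a a0 ax]; apply: nx; exists a => //.
by exists (fun=> 0); rewrite ax big1 // => i _; rewrite scale0r.
Qed.

Lemma nontorsion_indep h n i : indep h n -> (i < n)%N -> h i \notin @torsion A M.
Proof. by move=> hn lti; exact/nontorsion_of_notin_rat_span/(indep_notin_rat_span hn). Qed.

(** Elements of l are appended to h whenever they are rationally independent of
    what is already there; q collects the denominators of the others. *)
Lemma extend_indep h n (l : seq M) : indep h n ->
  exists m, exists h', exists2 q : A, q != 0 &
  [/\ (n <= m)%N, forall i, (i < n)%N -> h' i = h i, indep h' m &
      forall x, x \in l -> in_span h' m (q *: x)].
Proof.
move=> hn; elim: l => [|x l [m [h' [q q0 [nm eh hm hl]]]]].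
  by exists n, h, 1; rewrite ?oner_eq0.
have [[a a0 sp]|nsp] := pselect (in_rat_span h' m x).
  exists m, h', (q * a); first by rewrite mulf_neq0.
  split => // y; rewrite inE => /predU1P[->|yl]; first by rewrite -scalerA; exact: in_spanZ.
  by rewrite mulrC -scalerA; apply: in_spanZ; exact: hl.
pose h2 i := if (i < m)%N then h' i else x.
have e2 i : (i < m)%N -> h' i = h2 i by rewrite /h2 => ->.
have h2m : indep h2 m.+1.
  apply: indepS; first exact: indep_eq e2 hm.
  rewrite {2}/h2 ltnn => -[a a0 sp]; apply: nsp; exists a => //.
  by apply: in_span_eq sp => i /e2.
exists m.+1, h2, q => //; split => //; first exact: leqW.
  by move=> i lti; rewrite -e2 ?eh // (leq_trans lti).
move=> y; rewrite inE => /predU1P[->|yl].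
  apply: in_spanZ; rewrite (_ : x = h2 m); last by rewrite /h2 ltnn.
  exact: in_span_mem.
by apply: (in_span_widen (leqnSn m)); apply: in_span_eq (hl _ yl).
Qed.

(** An independent family of a finitely generated module can be completed to one
    whose span contains a nonzero multiple of the module. *)
Lemma complete_indep h n : finitely_generated M -> indep h n ->
  exists m, exists h', exists2 q : A, q != 0 &
  [/\ (n <= m)%N, forall i, (i < n)%N -> h' i = h i, indep h' m &
      forall x, in_span h' m (q *: x)].
Proof.
move=> [k [g gP]] hn.
have [m [h' [q q0 [nm eh hm hl]]]] := extend_indep [seq g i | i <- enum 'I_k] hn.
exists m, h', q => //; split => // x; have [c ->] := gP x.
rewrite scaler_sumr; apply: in_span_sum => i.
rewrite scalerA mulrC -scalerA; apply: in_spanZ; apply: hl.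
by apply/map_f; rewrite mem_enum.
Qed.

Lemma sum_notin_rat_span (e : nat -> M) n m (c : nat -> A) : indep e n ->
  (m < n)%N -> c m != 0 -> ~ in_rat_span e m (\sum_(i < n) c i *: e i).
Proof.
move=> en ltm cm [a a0 [c' h]].
rewrite (widen_sum _ _ (ltnW ltm)) scaler_sumr in h.
have := @indep_coef _ _ e n (fun i => a * c i)
  (fun i => if (i < m)%N then c' i else 0) en.
under [X in X = _ -> _]eq_bigr do rewrite -scalerA.
move=> /(_ h m ltm) /eqP; rewrite ltnn mulf_eq0 (negbTE a0) (negbTE cm) //.
Qed.

Lemma in_rat_span_eq (e e' : nat -> M) n x :
  (forall i, (i < n)%N -> e i = e' i) -> in_rat_span e n x -> in_rat_span e' n x.
Proof. by move=> ee' [a a0 sp]; exists a => //; exact: in_span_eq sp. Qed.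

End RationalSpan.

Section Steinitz.
Variables (F : fieldType) (V : lmodType F).

Lemma indep_le_span (x y : nat -> V) n m : indep x n ->
  (forall i, (i < n)%N -> in_span y m (x i)) -> (n <= m)%N.
Proof.
move=> xi xy.
have /choice[c cP] : forall i : 'I_n, exists c : 'I_m -> F, x i = \sum_j c j *: y j.
  by move=> i; apply/in_spanP/xy.
pose C : 'M[F]_(n, m) := \matrix_(i, j) c i j.
have kC : kermx C = 0.
  apply/row_matrixP => k; rewrite row0; apply/rowP => i; rewrite [RHS]mxE.
  move/indepP: xi; apply => {i}.
  transitivity (\sum_j (row k (kermx C) *m C) 0 j *: y j).
    under eq_bigr => i _ do rewrite cP scaler_sumr.
    rewrite exchange_big; apply: eq_bigr => j _ /=.
    rewrite mxE scaler_suml; apply: eq_bigr => i _.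
    by rewrite scalerA [C i j]mxE.
  rewrite (_ : _ *m C = 0); last by rewrite -row_mul mulmx_ker row0.
  by rewrite big1 // => j _; rewrite mxE scale0r.
have := mxrank_ker C; rewrite kC mxrank0 => /esym/eqP; rewrite subn_eq0.
by move/leq_trans; apply; exact: rank_leq_col.
Qed.

End Steinitz.

Section ModTorsion.
Variables (A : idomainType) (H : lmodType A).

Lemma to_mod_torsion_sum n (c : nat -> A) (e : nat -> H) :
  to_mod_torsion (\sum_(i < n) c i *: e i) = \sum_(i < n) c i *: to_mod_torsion (e i).
Proof. by rewrite raddf_sum; apply: eq_bigr => i _; rewrite /= -[LHS]mod_torsion_scaleE. Qed.

Lemma mod_torsion_spanP n (e : nat -> H) x (c : nat -> A) :
  (x - \sum_(i < n) c i *: e i \in @torsion A H) <->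
  to_mod_torsion x = \sum_(i < n) c i *: to_mod_torsion (e i).
Proof. by rewrite -to_mod_torsion_sum -to_mod_torsion_eq; split => [/eqP|->]. Qed.

Lemma indep_of_mod_torsion n (e : nat -> H) :
  indep (fun i => to_mod_torsion (e i)) n -> indep e n.
Proof. by move=> en c cs; apply: en; rewrite -to_mod_torsion_sum cs raddf0. Qed.

Lemma indep_mod_torsion n (e : nat -> H) :
  indep e n -> indep (fun i => to_mod_torsion (e i)) n.
Proof.
move=> en c; rewrite -to_mod_torsion_sum -(raddf0 (@to_mod_torsion A H)) => /eqP.
rewrite to_mod_torsion_eq subr0 => /asboolP[a a0]; rewrite scaler_sumr.
under eq_bigr do rewrite scalerA.
move=> /(en (fun i => a * c i)) ac i lti; apply/eqP.
by move/eqP: (ac i lti); rewrite mulf_eq0 (negbTE a0).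
Qed.

End ModTorsion.

(** * Non-Archimedean norms over valued fields *)

(** A real valuation of a field, given by its values on the nonzero elements; the
    value at 0 is irrelevant, 0 being treated apart by [ord_ge] and [ord_gt]. *)
Record valuation (R : realType) (F : fieldType) := Valuation {
  ord :> F -> R ;
  ordM : forall a b, a != 0 -> b != 0 -> ord (a * b) = ord a + ord b ;
  ordD : forall a b, a != 0 -> b != 0 -> a + b != 0 ->
    Num.min (ord a) (ord b) <= ord (a + b)
}.

(** A non-Archimedean norm on a vector space over a valued field, written
    additively, with the convention that multiplication by a scalar of large
    order decreases the norm. The value at 0 is irrelevant, as above. *)
Record gauge (R : realType) (F : fieldType) (w : valuation R F) (V : lmodType F) :=
  Gauge {
  gnorm :> V -> R ;
  gnormZ : forall a x, a != 0 -> x != 0 -> gnorm (a *: x) = gnorm x - w a ;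
  gnormD : forall x y, x != 0 -> y != 0 -> x + y != 0 ->
    gnorm (x + y) <= Num.max (gnorm x) (gnorm y)
}.

Section Valuation.
Context {R : realType} {F : fieldType} (w : valuation R F).
Implicit Types (a b : F) (c d : R).

(** the order of a is at least (resp. above) c, the order of 0 being infinite *)
Definition ord_ge c a : bool := (a == 0) || (c <= w a).
Definition ord_gt c a : bool := (a == 0) || (c < w a).

(** Completeness in the form used below: a sequence whose k-th increment has order
    at least k has a limit, approached at the same rate. *)
Definition complete : Prop := forall f : nat -> F,
  (forall k, ord_ge k%:R (f k.+1 - f k)) ->
  exists l, forall k, ord_ge k%:R (l - f k).

Lemma ord1 : w 1 = 0.
Proof.
by have := ordM w (oner_neq0 F) (oner_neq0 F); rewrite mulr1 => h; lra.
Qed.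

Lemma ordV a : a != 0 -> w a^-1 = - w a.
Proof.
move=> a0; have := @ordM _ _ w a a^-1 a0; rewrite invr_eq0 => /(_ a0).
by rewrite mulfV // ord1 => h; lra.
Qed.

Lemma ordN1 : w (-1) = 0.
Proof.
have n1 : (-1 : F) != 0 by rewrite oppr_eq0 oner_eq0.
by have := ordM w n1 n1; rewrite mulrNN mulr1 ord1 => h; lra.
Qed.

Lemma ordN a : w (- a) = w a.
Proof.
have [->|a0] := eqVneq a 0; first by rewrite oppr0.
by rewrite -mulN1r ordM ?oppr_eq0 ?oner_eq0 // ordN1 add0r.
Qed.

Lemma ord_ge_refl a : ord_ge (w a) a.
Proof. by rewrite /ord_ge lexx orbT. Qed.

Lemma ord_gtW c a : ord_gt c a -> ord_ge c a.
Proof. by rewrite /ord_gt /ord_ge; case: eqP => //= _; exact: ltW. Qed.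

Lemma ord_ge_nz c a : a != 0 -> ord_ge c a = (c <= w a).
Proof. by rewrite /ord_ge => /negbTE ->. Qed.

Lemma ord_gt_nz c a : a != 0 -> ord_gt c a = (c < w a).
Proof. by rewrite /ord_gt => /negbTE ->. Qed.

Lemma ord_geD c a b : ord_ge c a -> ord_ge c b -> ord_ge c (a + b).
Proof.
rewrite /ord_ge; have [->|a0] := eqVneq a 0; first by rewrite add0r.
have [->|b0] := eqVneq b 0; first by rewrite addr0 (negbTE a0).
have [//|ab0] := eqVneq (a + b) 0 => /= ca cb.
by apply: le_trans (ordD w a0 b0 ab0); rewrite le_min ca.
Qed.

Lemma ord_geN c a : ord_ge c (- a) = ord_ge c a.
Proof. by rewrite /ord_ge oppr_eq0 ordN. Qed.

Lemma ord_gtD c a b : ord_gt c a -> ord_gt c b -> ord_gt c (a + b).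
Proof.
rewrite /ord_gt; have [->|a0] := eqVneq a 0; first by rewrite add0r.
have [->|b0] := eqVneq b 0; first by rewrite addr0 (negbTE a0).
have [//|ab0] := eqVneq (a + b) 0 => /= ca cb.
by apply: lt_le_trans (ordD w a0 b0 ab0); rewrite lt_min ca.
Qed.

Lemma ord_close a b : a != 0 -> ord_gt (w a) (a - b) -> b != 0 /\ w b = w a.
Proof.
move=> a0 h; have b0 : b != 0.
  by apply: contraTneq h => ->; rewrite subr0 ord_gt_nz // ltxx.
split => //; apply/eqP; rewrite eq_le; apply/andP; split; last first.
  rewrite -(ord_ge_nz (w a) b0) -[b](subKr a); apply: ord_geD.
    exact: ord_ge_refl.
  by rewrite ord_geN ord_gtW.
have [//|ltab] := leP (w b) (w a).
have : ord_gt (w a) (a - b + b) by apply: ord_gtD => //; rewrite ord_gt_nz.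
by rewrite subrK ord_gt_nz // ltxx.
Qed.

End Valuation.

Section Gauge.
Context {R : realType} {F : fieldType} {w : valuation R F} {V : lmodType F}.
Variable N : gauge w V.
Implicit Types (a b : F) (x y : V) (r s : R).

(** closed and open balls about 0 *)
Definition ball_le r x : bool := (x == 0) || (N x <= r).
Definition ball_lt r x : bool := (x == 0) || (N x < r).

Lemma ball_le0 r : ball_le r 0. Proof. by rewrite /ball_le eqxx. Qed.
Lemma ball_lt0 r : ball_lt r 0. Proof. by rewrite /ball_lt eqxx. Qed.

Lemma ball_le_nz r x : x != 0 -> ball_le r x = (N x <= r).
Proof. by rewrite /ball_le => /negbTE ->. Qed.

Lemma ball_lt_nz r x : x != 0 -> ball_lt r x = (N x < r).
Proof. by rewrite /ball_lt => /negbTE ->. Qed.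

Lemma ball_le_norm x : ball_le (N x) x.
Proof. by rewrite /ball_le lexx orbT. Qed.

Lemma ball_leW r s x : r <= s -> ball_le r x -> ball_le s x.
Proof. by rewrite /ball_le; case: eqP => //= _ rs /le_trans; apply. Qed.

Lemma ball_leD r x y : ball_le r x -> ball_le r y -> ball_le r (x + y).
Proof.
rewrite /ball_le; have [->|x0] := eqVneq x 0; first by rewrite add0r.
have [->|y0] := eqVneq y 0; first by rewrite addr0 (negbTE x0).
have [//|xy0] := eqVneq (x + y) 0 => /= rx ry.
by apply: le_trans (gnormD N x0 y0 xy0) _; rewrite ge_max rx.
Qed.

Lemma ball_ltD r x y : ball_lt r x -> ball_lt r y -> ball_lt r (x + y).
Proof.
rewrite /ball_lt; have [->|x0] := eqVneq x 0; first by rewrite add0r.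
have [->|y0] := eqVneq y 0; first by rewrite addr0 (negbTE x0).
have [//|xy0] := eqVneq (x + y) 0 => /= rx ry.
by apply: le_lt_trans (gnormD N x0 y0 xy0) _; rewrite gt_max rx.
Qed.

Lemma gnormN x : N (- x) = N x.
Proof.
have [->|x0] := eqVneq x 0; first by rewrite oppr0.
by rewrite -scaleN1r gnormZ ?oppr_eq0 ?oner_eq0 // ordN1 subr0.
Qed.

Lemma ball_leN r x : ball_le r (- x) = ball_le r x.
Proof. by rewrite /ball_le oppr_eq0 gnormN. Qed.

Lemma ball_ltN r x : ball_lt r (- x) = ball_lt r x.
Proof. by rewrite /ball_lt oppr_eq0 gnormN. Qed.

Lemma ball_leB r x y : ball_le r x -> ball_le r y -> ball_le r (x - y).
Proof. by move=> rx ry; apply: ball_leD; rewrite ?ball_leN. Qed.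

Lemma ball_ltB r x y : ball_lt r x -> ball_lt r y -> ball_lt r (x - y).
Proof. by move=> rx ry; apply: ball_ltD; rewrite ?ball_ltN. Qed.

Lemma ball_le_sum I (s : seq I) (P : pred I) r (f : I -> V) :
  (forall i, P i -> ball_le r (f i)) -> ball_le r (\sum_(i <- s | P i) f i).
Proof.
by move=> h; elim/big_ind: _ => //; [exact: ball_le0|exact: ball_leD].
Qed.

Lemma ball_lt_sum I (s : seq I) (P : pred I) r (f : I -> V) :
  (forall i, P i -> ball_lt r (f i)) -> ball_lt r (\sum_(i <- s | P i) f i).
Proof.
by move=> h; elim/big_ind: _ => //; [exact: ball_lt0|exact: ball_ltD].
Qed.

Lemma ball_leZ r c a x : ball_le r x -> ord_ge w c a -> ball_le (r - c) (a *: x).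
Proof.
rewrite /ball_le /ord_ge scaler_eq0; have [//|a0] := eqVneq a 0.
have [//|x0] := eqVneq x 0 => /= rx ca.
by rewrite gnormZ //; lra.
Qed.

Lemma ball_ltZ r c a x : ball_le r x -> ord_gt w c a -> ball_lt (r - c) (a *: x).
Proof.
rewrite /ball_lt /ball_le /ord_gt scaler_eq0; have [//|a0] := eqVneq a 0.
have [//|x0] := eqVneq x 0 => /= rx ca.
by rewrite gnormZ //; lra.
Qed.

Lemma gnorm_max x y : x != 0 -> y != 0 -> N x < N y ->
  x + y != 0 /\ N (x + y) = N y.
Proof.
move=> x0 y0 xy; have xy0 : x + y != 0.
  apply: contraTneq xy => /eqP; rewrite addr_eq0 => /eqP ->.
  by rewrite gnormN ltxx.
split => //; apply/eqP; rewrite eq_le; apply/andP; split.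
  by apply: le_trans (gnormD N x0 y0 xy0) _; rewrite ge_max lexx ltW.
have [//|lt] := leP (N y) (N (x + y)).
have : ball_lt (N y) (x + y - x) by apply: ball_ltB; rewrite ball_lt_nz.
by rewrite addrC addKr ball_lt_nz // ltxx.
Qed.

Lemma ball_le_all x : (forall k : nat, ball_le (- k%:R) x) -> x = 0.
Proof.
move=> h; apply/eqP; have [//|x0] := eqVneq x 0.
have := h (Num.truncn (- N x)).+1; rewrite ball_le_nz // lerNr.
by rewrite leNgt truncnS_gt.
Qed.

Lemma norm_le_family (e : nat -> V) n : exists D, forall i, (i < n)%N -> N (e i) <= D.
Proof.
exists (\sum_(i < n) `|N (e i)|) => i lti.
rewrite (bigD1 (Ordinal lti)) //=; apply: le_trans (ler_norm _) _.
by rewrite lerDl sumr_ge0.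
Qed.

(** Over a complete field, the norm of a linear combination of independent vectors
    controls the coefficients: the span of the first n vectors is complete, hence
    the next one stays at a bounded distance from it. *)
Theorem norm_controls_coef (e : nat -> V) n : complete w -> indep e n ->
  exists C, forall (c : nat -> F) r, ball_le r (\sum_(i < n) c i *: e i) ->
    forall i, (i < n)%N -> ord_ge w (- r - C) (c i).
Proof.
move=> cw; elim: n => [|n IHn] en; first by exists 0.
have [C hC] := IHn (indep_prefix (leqnSn n) en).
have [D hD] := norm_le_family e n.
(* e n stays at a bounded distance from the span of its predecessors *)
have [C0 hC0] : exists C0, forall c : nat -> F,
    ~~ ball_le (- C0) (e n + \sum_(i < n) c i *: e i).
  (* otherwise combinations c k approach - e n, have converging coefficients by
     induction, and their limit puts e n in the span *)
  apply: contrapT => /forallNP no.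
  have /choice[c cP] : forall k : nat, exists c : nat -> F,
      ball_le (- (k%:R + C)) (e n + \sum_(i < n) c i *: e i).
    move=> k; have /existsNP[c /negP] := no (k%:R + C); rewrite negbK => hc.
    by exists c.
  have /choice[l lP] : forall i, exists l, (i < n)%N ->
      forall k, ord_ge w k%:R (l - c k i).
    move=> i; have [lti|] := boolP (i < n)%N; last by exists 0.
    have [|l lP] := cw (c^~ i); last by exists l.
    move=> k; rewrite (_ : k%:R = - (- (k%:R + C)) - C); last lra.
    apply: (hC (fun i => c k.+1 i - c k i)) => //.
    under eq_bigr do rewrite scalerBl.
    rewrite sumrB (_ : _ - _ = (e n + \sum_(i < n) c k.+1 i *: e i) -
      (e n + \sum_(i < n) c k i *: e i)); last by rewrite opprD addrACA subrr add0r.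
    apply: ball_leB => //.
    by apply: ball_leW (cP k.+1); rewrite lerN2 lerD2r ler_nat.
  have : e n + \sum_(i < n) l i *: e i = 0.
    apply: ball_le_all => k.
    have [j jP] : exists j : nat, k%:R - C <= j%:R /\ k%:R + D <= j%:R.
      exists (Num.truncn (Num.max (k%:R - C) (k%:R + D))).+1.
      by have := truncnS_gt (Num.max (k%:R - C) (k%:R + D));
        rewrite gt_max => /andP[? ?]; split; exact: ltW.
    rewrite (_ : _ + _ = (e n + \sum_(i < n) c j i *: e i) +
        \sum_(i < n) (l i - c j i) *: e i); last first.
      by under [X in _ = _ + X]eq_bigr do rewrite scalerBl; rewrite sumrB addrACA subrr addr0 addrC.
    apply: ball_leD; first by apply: ball_leW (cP j); lra.
    apply: ball_le_sum => i _; apply: (@ball_leW (D - j%:R)); first lra.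
    by apply: ball_leZ; [rewrite /ball_le hD ?orbT|exact: lP].
  move=> s0; pose c' i := if (i < n)%N then l i else 1.
  have := en c'; rewrite big_ord_recr /= {2}/c' ltnn scale1r addrC.
  rewrite (eq_bigr (fun i : 'I_n => l i *: e i)); last first.
    by move=> i _; rewrite /c' ltn_ord.
  move=> /(_ s0 n (ltnSn n)); rewrite /c' ltnn => /eqP; rewrite oner_eq0 //.
pose D' := Num.max 0 (N (e n) + C0).
exists (Num.max C0 (D' + C)) => c r; rewrite big_ord_recr /= => hr.
(* the last coefficient is bounded after dividing by it, then the others by
   induction after subtracting the last term *)
have cn : ord_ge w (- r - C0) (c n).
  have [cn0|cn0] := eqVneq (c n) 0; first by rewrite cn0 /ord_ge eqxx.
  rewrite ord_ge_nz //; have := hC0 (fun i => (c n)^-1 * c i).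
  have [//|wl] := leP (- r - C0) (w (c n)); move/negP; case.
  rewrite (_ : _ + _ = (c n)^-1 *: (\sum_(i < n) c i *: e i + c n *: e n)).
    apply: (@ball_leW (r - w (c n)^-1)); first by rewrite ordV //; lra.
    by apply: ball_leZ => //; exact: ord_ge_refl.
  rewrite scalerDr scalerA mulVf // scale1r addrC scaler_sumr; congr (_ + _).
  by apply: eq_bigr => i _; rewrite scalerA.
have D0 : 0 <= D' by rewrite le_max lexx.
have D1 : N (e n) + C0 <= D' by rewrite le_max lexx orbT.
have low i : (i < n)%N -> ord_ge w (- r - (D' + C)) (c i).
  rewrite (_ : _ - _ = - (r + D') - C); last lra.
  apply: hC.
  rewrite -[X in ball_le _ X](addrK (c n *: e n)); apply: ball_leB.
    by apply: ball_leW hr; lra.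
  apply: (@ball_leW (N (e n) - (- r - C0))); first lra.
  by apply: ball_leZ => //; exact: ball_le_norm.
have m1 : C0 <= Num.max C0 (D' + C) by rewrite le_max lexx.
have m2 : D' + C <= Num.max C0 (D' + C) by rewrite le_max lexx orbT.
have mono_ge s1 s2 a : s2 <= s1 -> ord_ge w s1 a -> ord_ge w s2 a.
  by rewrite /ord_ge; case: eqP => //= _ ss /(le_trans ss).
move=> i; rewrite ltnS leq_eqVlt => /predU1P[->|/low].
  by apply: mono_ge cn; rewrite lerD2l lerN2.
by apply: mono_ge; rewrite lerD2l lerN2.
Qed.

End Gauge.

(** Orthogonality in terms of balls: no term of a linear combination has a larger
    norm than the whole. *)
Definition orthogonal_family (R : realType) (F : fieldType) (w : valuation R F)
    (V : lmodType F) (N : gauge w V) (x : nat -> V) n : Prop :=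
  forall (l : nat -> F) r, ball_le N r (\sum_(i < n) l i *: x i) ->
  forall i, (i < n)%N -> ball_le N r (l i *: x i).

(** * Independence after extension of scalars, and the rank *)

Section ScalarExtensionBasis.
Variables (A : idomainType) (F : fieldType) (iota : {rmorphism A -> F}).
Hypothesis iota_inj : injective iota.
Variables (H : lmodType A) (V : lmodType F).
Variable phi : {linear H -> V | iota \; *:%R}.
Hypothesis phi_iso : bijective (ext_map phi).

Let iota_neq0 a : a != 0 -> iota a != 0.
Proof. by rewrite -(rmorph0 iota) (inj_eq iota_inj). Qed.

Lemma phi_sum n (c : nat -> A) (h : nat -> H) :
  phi (\sum_(i < n) c i *: h i) = \sum_(i < n) iota (c i) *: phi (h i).
Proof. by rewrite raddf_sum; apply: eq_bigr => i _; rewrite /= linearZ. Qed.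

Lemma phi_torsion x : x \in @torsion A H -> phi x = 0.
Proof.
move=> /asboolP[a a0 ax]; have /eqP : iota a *: phi x = 0.
  by have := congr1 phi ax; rewrite linearZ raddf0.
by rewrite scaler_eq0 (negbTE (iota_neq0 a0)) => /eqP.
Qed.

(** The coordinates of q x in the family are linear in x, hence extend to the
    scalar extension, where they separate the images of the family. *)
Lemma phi_indep_max (h : nat -> H) n q : q != 0 -> indep h n ->
  (forall x, in_span h n (q *: x)) -> indep (fun i => phi (h i)) n.
Proof.
move=> q0 hn hq l l0 k ltk.
have /choice[c cP] : forall x, exists c : nat -> A, q *: x = \sum_(i < n) c i *: h i.
  by move=> x; exact: hq.
have c_lin : linear_for (iota \; *:%R) (fun x => iota (c x k) : F^o).
  move=> a x y; change (iota (c (a *: x + y) k) = iota a * iota (c x k) + iota (c y k)).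
  rewrite -rmorphM -rmorphD; congr (iota _).
  apply: (@indep_coef _ _ h n (c (a *: x + y)) (fun i => a * c x i + c y i)) => //.
  under [RHS]eq_bigr do rewrite scalerDl -scalerA.
  by rewrite big_split -scaler_sumr -!cP scalerDr !scalerA mulrC.
pose psi : {linear H -> F^o | iota \; *:%R} :=
  HB.pack (fun x => iota (c x k) : F^o) (GRing.isLinear.Build _ _ _ _ _ c_lin).
pose s : seq (F * H) := [seq (l i, h i) | i : 'I_n].
have s0 : tensor_class iota s = tensor_class iota [::].
  apply: (bij_inj phi_iso); rewrite !ext_mapE big_nil big_map big_enum /=.
  exact: l0.
have /= := congr1 (ext_map psi) s0; rewrite !ext_mapE big_nil big_map big_enum /=.
rewrite (bigD1 (Ordinal ltk)) //= big1 ?addr0 => [|i /negbTE ik].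
  have -> : c (h k) k = q.
    have := @indep_coef _ _ h n (c (h k)) (fun i => if i == k then q else 0) hn.
    by rewrite sum_indicator // -cP => /(_ erefl k ltk); rewrite eqxx.
  move=> /eqP; rewrite -[_ *: _]/(_ * _) mulf_eq0 (negbTE (iota_neq0 q0)) orbF.
  by move/eqP.
have -> : c (h i) k = 0.
  have := @indep_coef _ _ h n (c (h i)) (fun j => if j == i then q else 0) hn.
  rewrite sum_indicator // -cP => /(_ erefl k ltk) ->.
  by rewrite eq_sym; move: ik; rewrite -val_eqE /= => ->.
by rewrite rmorph0 scaler0.
Qed.

Lemma phi_span_max (h : nat -> H) n q : q != 0 ->
  (forall x, in_span h n (q *: x)) -> forall v, in_span (fun i => phi (h i)) n v.
Proof.
move=> q0 hq v; have [g _ gK] := phi_iso; rewrite -(gK v).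
elim/tensor_classW: (g v) => s; rewrite ext_mapE.
elim: s => [|p s IHs]; first by exists (fun=> 0); rewrite big_nil big1 // => i _; rewrite scale0r.
rewrite big_cons; apply: in_spanD IHs; apply: in_spanZ.
have [c e] := hq p.2; rewrite -[phi _](scalerK (iota_neq0 q0)); apply: in_spanZ.
have := congr1 phi e; rewrite linearZ phi_sum /= => ->.
by exists (fun i => iota (c i)).
Qed.

Hypothesis H_fg : finitely_generated H.

Lemma phi_indep (h : nat -> H) n : indep h n -> indep (fun i => phi (h i)) n.
Proof.
move=> hn; have [m [h' [q q0 [nm eh hm hq]]]] := complete_indep H_fg hn.
apply: (@indep_eq _ _ (fun i => phi (h' i))) => [i lti|]; first by rewrite eh.
exact/(indep_prefix nm)/(phi_indep_max q0).
Qed.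

Lemma phi_neq0 x : x \notin @torsion A H -> phi x != 0.
Proof.
move=> xt; apply/eqP => px.
have x1 : indep (fun=> x) 1.
  move=> c; rewrite big_ord_recl big_ord0 addr0 => cx i; rewrite ltnS leqn0 => /eqP ->.
  by apply: contraNeq xt => c0; apply/asboolP; exists (c 0%N).
have := @phi_indep (fun=> x) 1 x1 (fun=> 1).
rewrite big_ord_recl big_ord0 addr0 px scaler0 => /(_ erefl 0%N isT) /eqP.
by rewrite oner_eq0.
Qed.

(** An independent family of the largest possible size n spans a nonzero multiple
    of H, and its image spans V. *)
Lemma phi_span_of_indep (h : nat -> H) n : indep h n ->
  (forall (h' : nat -> H) m, indep h' m -> (m <= n)%N) ->
  (exists2 q, q != 0 & forall x, in_span h n (q *: x)) /\
  (forall v, in_span (fun i => phi (h i)) n v).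
Proof.
move=> hn hmax; have [m [h' [q q0 [nm eh hm hq]]]] := complete_indep H_fg hn.
have e : m = n by apply/eqP; rewrite eqn_leq nm (hmax h').
subst m; have hq' x : in_span h n (q *: x) by apply: in_span_eq (hq x).
by split; [exists q|exact: phi_span_max hq'].
Qed.

End ScalarExtensionBasis.

Section Rank.
Variables (A : idomainType) (H : lmodType A) (d : nat).
Hypothesis H_fg : finitely_generated H.

Let Q := {fraction A}.
Let ext := scalar_ext (@FracField.tofrac A) H.

(* the map x |-> 1 (x) x, whose extension of scalars is the identity *)
Let unit_tensor (x : H) : ext := tensor (@FracField.tofrac A) 1 x.

Let unit_tensor_linear : linear_for ((@FracField.tofrac A) \; *:%R) unit_tensor.
Proof.
move=> a x y; change (unit_tensor (a *: x + y) =
  ext_add (ext_scale (FracField.tofrac a) (unit_tensor x)) (unit_tensor y)).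
rewrite /unit_tensor /tensor ext_scaleE /= mulr1.
rewrite [RHS]ext_addE; apply/tensor_classP.
apply: tensor_trans (tensor_addr _ _ _ _) _.
rewrite -cat1s; apply: tensor_cat; last exact: tensor_refl.
by rewrite -[X in tensor_rel _ _ [:: (X, _)]]mul1r; apply/tensor_sym/tensor_balanced.
Qed.

(** The rank is the largest size of an independent family of H. *)
Lemma rank_spec : has_dim ext d ->
  (exists h : nat -> H, indep h d) /\ (forall (h : nat -> H) m, indep h m -> (m <= d)%N).
Proof.
pose phi : {linear H -> ext | (@FracField.tofrac A) \; *:%R} :=
  HB.pack unit_tensor (GRing.isLinear.Build _ _ _ _ _ unit_tensor_linear).
have phiE s : ext_map phi (tensor_class _ s) = tensor_class _ s.
  rewrite ext_mapE; elim: s => [|[b x] s IHs]; first by rewrite big_nil.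
  rewrite big_cons IHs /= [X in X + _]ext_scaleE /= mulr1 [LHS]ext_addE //.
have phi_iso : bijective (ext_map phi).
  by exists id; elim/tensor_classW => s; rewrite phiE.
have iota_inj : injective (@FracField.tofrac A).
  by move=> x y /eqP; rewrite tofrac_eq => /eqP.
move=> [e [e_indep e_span]].
pose e' := extend e.
have e'i : indep e' d.
  by apply/indepP; rewrite (_ : (fun i : 'I_d => e' i) = e) //; apply/funext => i; rewrite /e' extendE.
have e's v : in_span e' d v.
  apply/in_spanP; have [c ->] := e_span v; exists c.
  by apply: eq_bigr => i _; rewrite /e' extendE.
have le_d (h : nat -> H) m : indep h m -> (m <= d)%N.
  move=> hm; apply: (@indep_le_span Q ext (fun i => phi (h i)) e').
    exact: (phi_indep iota_inj phi_iso).
  by move=> i _; exact: e's.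
split => //.
have h0 : indep (fun=> 0 : H) 0 by [].
have [m [h [q q0 [_ _ hm hq]]]] := complete_indep H_fg h0.
suff dm : (d <= m)%N by exists h; exact: indep_prefix hm.
apply: (indep_le_span e'i) => i _; exact: (phi_span_max iota_inj phi_iso q0 hq).
Qed.

End Rank.

(** * Successive minima of the height *)

(** Every element of F1 agrees, up to terms of order above k, with an element of A
    whose order at the other place is at least - k. For the two Novikov fields, whose
    orders are the lowest exponent and minus the highest one, this is the truncation
    of a series at the exponent k. *)
Definition truncation (R : realType) (A : idomainType) (F1 F2 : fieldType)
    (iota1 : A -> F1) (iota2 : A -> F2)
    (w1 : valuation R F1) (w2 : valuation R F2) : Prop :=
  forall (l : F1) (k : R), exists p : A,
    ord_gt w1 k (l - iota1 p) /\ ord_ge w2 (- k) (iota2 p).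

Section OneSide.
Context {R : realType} {A : idomainType} {F1 F2 : fieldType}.
Context {iota1 : {rmorphism A -> F1}} {iota2 : {rmorphism A -> F2}}.
Context {w1 : valuation R F1} {w2 : valuation R F2}.
Context {H : lmodType A} {V1 : lmodType F1} {V2 : lmodType F2}.
Context {phi1 : {linear H -> V1 | iota1 \; *:%R}}.
Context {phi2 : {linear H -> V2 | iota2 \; *:%R}}.
Hypothesis iota1_inj : injective iota1.
Hypothesis iota2_inj : injective iota2.
Hypothesis phi1_neq0 : forall x, x \notin @torsion A H -> phi1 x != 0.
Hypothesis phi2_neq0 : forall x, x \notin @torsion A H -> phi2 x != 0.
Hypothesis ord_sum_le0 : forall a, a != 0 -> w1 (iota1 a) + w2 (iota2 a) <= 0.
Hypothesis trunc12 : truncation iota1 iota2 w1 w2.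
Hypothesis trunc21 : truncation iota2 iota1 w2 w1.
Variables (N1 : gauge w1 V1) (N2 : gauge w2 V2).

(** The truncation at the order of l is an analogue of the leading monomial: its
    orders at the two places are opposite. *)
Lemma leading_term (l : F1) : l != 0 -> exists m : A,
  [/\ m != 0, w2 (iota2 m) = - w1 l & ord_gt w1 (w1 l) (l - iota1 m)].
Proof.
move=> l0; have [m [h1 h2]] := trunc12 l (w1 l); exists m.
have [im0 wm] := ord_close l0 h1.
have m0 : m != 0 by apply: contraNneq im0 => ->; rewrite rmorph0.
split => //; apply/eqP; rewrite eq_le; apply/andP; split.
  by have := ord_sum_le0 m0; rewrite wm => ?; lra.
by rewrite -(ord_ge_nz w2) // -(rmorph0 iota2) (inj_eq iota2_inj).
Qed.

(** For the norms rho_up and - rho_down this is rho_up - rho_down, the opposite of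
    the length whose suprema define the gaps. *)
Definition height (x : H) : R := N1 (phi1 x) + N2 (phi2 x).

(** Each e k minimizes the height among the elements that are rationally independent
    of its predecessors: the e k realize the successive minima of the height. *)
Definition greedy (e : nat -> H) n : Prop := indep e n /\
  forall k, (k < n)%N -> forall x, ~ in_rat_span e k x -> height (e k) <= height x.

Lemma greedy_le e n i j : greedy e n -> (i <= j < n)%N -> height (e i) <= height (e j).
Proof.
move=> [en gr] /andP[ij jn]; apply: gr; first exact: leq_ltn_trans jn.
move: ij; rewrite leq_eqVlt => /predU1P[->|ij]; first exact: indep_notin_rat_span en jn.
move=> [a a0 sp]; apply: (indep_notin_rat_span en jn); exists a => //.
exact: in_span_widen (ltnW ij) sp.
Qed.

(** Otherwise the leading terms of the coefficients of a cancelling combination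
    form an element of H which is smaller than expected at the first place and no
    larger than expected at the second, hence of too small a height. *)
Lemma greedy_orthogonal e n : greedy e n ->
  forall (l : nat -> F1) r, ball_le N1 r (\sum_(i < n) l i *: phi1 (e i)) ->
  forall i, (i < n)%N -> ball_le N1 r (l i *: phi1 (e i)).
Proof.
move=> ge l r hr; have [en gr] := ge.
have phie i : (i < n)%N -> phi1 (e i) != 0.
  by move=> lti; apply/phi1_neq0/(nontorsion_indep en).
pose nu (i : 'I_n) := N1 (phi1 (e i)) - w1 (l i).
have nuE (i : 'I_n) : l i != 0 -> N1 (l i *: phi1 (e i)) = nu i.
  by move=> li0; rewrite gnormZ // phie.
move=> i0 lti0; apply: contrapT => /negP; set i := Ordinal lti0.
rewrite -[i0]/(nat_of_ord i) /ball_le negb_or -ltNge scaler_eq0 negb_or.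
move=> /andP[/andP[li0 _]]; rewrite nuE // => r_lt.
have [j lj0 jmax] := @Order.TotalTheory.arg_maxP _ R _ i (fun i : 'I_n => l i != 0) nu li0.
pose s := nu j; have rs : r < s by apply: lt_le_trans r_lt _; exact: jmax.
pose I (k : nat) := [&& (k < n)%N, l k != 0 & N1 (phi1 (e k)) - w1 (l k) == s].
(* s is the largest norm of a term, I the set of the terms that attain it, m k a
   leading term of l k, and y the combination of the leading terms over I *)
have /choice[m mP] : forall k, exists m, l k != 0 ->
    [/\ m != 0, w2 (iota2 m) = - w1 (l k) & ord_gt w1 (w1 (l k)) (l k - iota1 m)].
  move=> k; have [->|lk0] := eqVneq (l k) 0; first by exists 0.
  by have [m ?] := leading_term lk0; exists m.
pose mu k := if I k then m k else 0.
have Ij : I j by rewrite /I ltn_ord lj0 /s /nu /=.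
have [M IM Mmax] := @arg_maxnP _ j (fun k : 'I_n => I k) (fun k => k : nat) Ij.
pose y := \sum_(k < n) mu k *: e k.
have muM : mu M != 0.
  by rewrite /mu IM; move: IM => /and3P[_ lM _]; have [] := mP _ lM.
have nsp : ~ in_rat_span e M y by exact: sum_notin_rat_span.
have yt := nontorsion_of_notin_rat_span nsp.
have N1y : N1 (phi1 y) < s.
  rewrite -(ball_lt_nz N1 s (phi1_neq0 yt)) phi_sum.
  rewrite (_ : \sum_(k < n) _ = \sum_(k < n) l k *: phi1 (e k) -
    \sum_(k < n) (l k - iota1 (mu k)) *: phi1 (e k)); last first.
    by under [X in _ - X]eq_bigr do rewrite scalerBl; rewrite sumrB subKr.
  apply: ball_ltB.
    by move: hr; rewrite /ball_le /ball_lt; case: eqP => //= _ /le_lt_trans; apply.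
  apply: ball_lt_sum => k _; rewrite /mu; case: ifP => [/and3P[_ lk /eqP es]|nI].
    rewrite -es; apply: ball_ltZ; first exact: ball_le_norm.
    by have [] := mP _ lk.
  rewrite rmorph0 subr0; have [->|lk0] := eqVneq (l k) 0; first by rewrite scale0r ball_lt0.
  rewrite /ball_lt nuE // lt_neqAle; apply/orP; right; apply/andP; split.
    by move: nI; rewrite /I ltn_ord lk0 /= => ->.
  exact: jmax.
have N2y : N2 (phi2 y) <= height (e M) - s.
  rewrite -(ball_le_nz N2 _ (phi2_neq0 yt)) phi_sum.
  apply: ball_le_sum => k _; rewrite /mu; case: ifP => [Ik|_]; last first.
    by rewrite rmorph0 scale0r ball_le0.
  move: (Ik) => /and3P[_ lk /eqP es]; have [_ w2m _] := mP _ lk.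
  apply: (@ball_leW _ _ _ _ _ (N2 (phi2 (e k)) - w2 (iota2 (m k)))).
    have hk : height (e k) <= height (e M).
      by apply: greedy_le ge _; rewrite ltn_ord andbT; exact: Mmax.
    by rewrite /height in hk *; rewrite w2m; lra.
  by apply: ball_leZ; [exact: ball_le_norm|exact: ord_ge_refl].
have := gr _ (ltn_ord M) _ nsp; rewrite [X in _ <= X]/height; lra.
Qed.

(** Write x = \sum (f i / q) e i. Removing from f i / q its truncations at both
    places, with threshold the first norm of e i, leaves a combination z of the e i
    whose coefficients have order at least that threshold at the first place, and
    above its opposite at the second. Hence the height of z is less than that of
    the last e i occurring in it, which is impossible unless no e i occurs. *)
Lemma greedy_spans e n : greedy e n -> (exists2 q, q != 0 & forall x, in_span e n (q *: x)) ->
  forall x, exists c : nat -> A, x - \sum_(i < n) c i *: e i \in @torsion A H.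
Proof.
move=> ge [q q0 hq] x; have [en gr] := ge; have [f fE] := hq x.
have iq1 : iota1 q != 0 by rewrite -(rmorph0 iota1) (inj_eq iota1_inj).
have iq2 : iota2 q != 0 by rewrite -(rmorph0 iota2) (inj_eq iota2_inj).
pose k i := N1 (phi1 (e i)).
have /choice[p pP] : forall i, exists p, ord_gt w1 (k i) (iota1 (f i) / iota1 q - iota1 p) /\
    ord_ge w2 (- k i) (iota2 p) by move=> i; exact: trunc12.
have /choice[p' p'P] : forall i, exists p', ord_gt w2 (- k i)
    (iota2 (f i - q * p i) / iota2 q - iota2 p') /\ ord_ge w1 (k i) (iota1 p').
  by move=> i; have := trunc21 (iota2 (f i - q * p i) / iota2 q) (- k i); rewrite opprK.
pose c i := p i + p' i; pose u i := f i - q * c i.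
pose z := x - \sum_(i < n) c i *: e i.
have qz : q *: z = \sum_(i < n) u i *: e i.
  rewrite scalerBr fE scaler_sumr -sumrB; apply: eq_bigr => i _.
  by rewrite scalerBl scalerA.
exists c; have [|nu0] := pselect (forall i, (i < n)%N -> u i = 0).
  move=> u0; apply/asboolP; exists q => //; rewrite qz big1 // => i _.
  by rewrite u0 // scale0r.
exfalso; apply: nu0 => i lti; apply: contrapT => /eqP ui0.
have [M uM Mmax] := @arg_maxnP _ (Ordinal lti) (fun k : 'I_n => u k != 0) (fun k => k : nat) ui0.
have nsp : ~ in_rat_span e M z.
  move=> [a a0 sp]; have := @sum_notin_rat_span _ _ e n M u en (ltn_ord M) uM; apply.
  by rewrite -qz; exists a => //; rewrite scalerA mulrC -scalerA; exact: in_spanZ.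
have zt := nontorsion_of_notin_rat_span nsp.
have phiZ1 a y : phi1 (a *: y) = iota1 a *: phi1 y by rewrite linearZ.
have phiZ2 a y : phi2 (a *: y) = iota2 a *: phi2 y by rewrite linearZ.
have phiz1 : phi1 z = \sum_(i < n) (iota1 (u i) / iota1 q) *: phi1 (e i).
  apply: (scalerI iq1); rewrite scaler_sumr -phiZ1 qz phi_sum.
  by apply: eq_bigr => j _; rewrite scalerA mulrC divfK.
have phiz2 : phi2 z = \sum_(i < n) (iota2 (u i) / iota2 q) *: phi2 (e i).
  apply: (scalerI iq2); rewrite scaler_sumr -phiZ2 qz phi_sum.
  by apply: eq_bigr => j _; rewrite scalerA mulrC divfK.
have N1z : N1 (phi1 z) <= 0.
  rewrite -(ball_le_nz N1 _ (phi1_neq0 zt)) phiz1; apply: ball_le_sum => j _.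
  rewrite -[0](subrr (k j)); apply: ball_leZ; first exact: ball_le_norm.
  rewrite (_ : _ / _ = iota1 (f j) / iota1 q - iota1 (p j) - iota1 (p' j)).
    apply: ord_geD; last by rewrite ord_geN; have [] := p'P j.
    by apply: ord_gtW; have [] := pP j.
  rewrite /u /c rmorphB rmorphM mulrBl [iota1 q * _]mulrC mulfK // rmorphD.
  by rewrite opprD addrA.
have N2z : N2 (phi2 z) < height (e M).
  rewrite -(ball_lt_nz N2 _ (phi2_neq0 zt)) phiz2; apply: ball_lt_sum => j _.
  have [->|uj0] := eqVneq (u j) 0; first by rewrite rmorph0 mul0r scale0r ball_lt0.
  have hj : height (e j) <= height (e M).
    by apply: greedy_le ge _; rewrite ltn_ord andbT; exact: Mmax.
  have : ball_lt N2 (N2 (phi2 (e j)) - - k j) ((iota2 (u j) / iota2 q) *: phi2 (e j)).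
    apply: ball_ltZ; first exact: ball_le_norm.
    rewrite (_ : _ / _ = iota2 (f j - q * p j) / iota2 q - iota2 (p' j)).
      by have [] := p'P j.
    rewrite /u /c mulrDr opprD addrA [in LHS]rmorphB mulrBl; congr (_ - _).
    by rewrite rmorphM mulrC mulKf.
  rewrite /ball_lt; case: eqP => //= _ /lt_le_trans; apply.
  by move: hj; rewrite {1}/height -/(k j) => ?; lra.
have := gr _ (ltn_ord M) _ nsp; rewrite [X in _ <= X]/height; lra.
Qed.

(** A greedy family exists as soon as the height attains its minimum on every set of
    non-torsion elements. *)
Lemma exists_greedy d :
  (forall (h : nat -> H) n, indep h n -> indep (fun i => phi1 (h i)) n) ->
  (exists h : nat -> H, indep h d) ->
  (forall P : H -> Prop, (exists x, P x) -> (forall x, P x -> x \notin @torsion A H) ->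
    exists2 x, P x & forall y, P y -> height x <= height y) ->
  exists e, greedy e d.
Proof.
move=> phi1_indep [h hd] min.
suff : forall k, (k <= d)%N -> exists e, greedy e k by exact.
elim=> [|k IHk] ltk; first by exists (fun=> 0); split.
have [e [ek gr]] := IHk (ltnW ltk).
have [||x xsp xmin] := min (fun x => ~ in_rat_span e k x).
- apply: contrapT => no; have := ltk; rewrite ltnNge => /negP; apply.
  apply: (indep_le_span (phi1_indep _ _ hd) (y := fun i => phi1 (e i))) => i _.
  have [[a a0 [c hc]]|ns] := pselect (in_rat_span e k (h i)); last first.
    by exfalso; apply: no; exists (h i).
  have ia : iota1 a != 0 by rewrite -(rmorph0 iota1) (inj_eq iota1_inj).
  rewrite -[phi1 _](scalerK ia); apply: in_spanZ; exists (fun j => iota1 (c j)).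
  by have := congr1 phi1 hc; rewrite linearZ phi_sum /= => ->.
- by move=> x /= /nontorsion_of_notin_rat_span.
pose e' i := if (i < k)%N then e i else x.
have ee' j : (j <= k)%N -> forall i, (i < j)%N -> e i = e' i.
  by move=> jk i ij; rewrite /e' (leq_trans ij jk).
have e'k : e' k = x by rewrite /e' ltnn.
have e'e j : (j <= k)%N -> forall z, in_rat_span e j z -> in_rat_span e' j z.
  by move=> jk z; apply: in_rat_span_eq; exact: ee'.
have ee'' j : (j <= k)%N -> forall z, in_rat_span e' j z -> in_rat_span e j z.
  by move=> jk z; apply: in_rat_span_eq => i ij; rewrite (ee' j).
exists e'; split.
  apply: indepS; first exact: indep_eq (ee' k (leqnn k)) ek.
  by rewrite e'k => /ee''; apply: contra_not xsp; apply.
move=> j; rewrite ltnS leq_eqVlt => /predU1P[->|jk] z zsp.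
  by rewrite e'k; apply: xmin => /e'e; apply: contra_not zsp; apply.
rewrite -(ee' k (leqnn k) j jk); apply: gr => //.
by move=> /(e'e _ (ltnW jk)).
Qed.

(** Both norms are bounded below by the orders of any one coefficient, and the two
    orders of a nonzero element of A have a nonpositive sum. *)
Lemma height_bounded_below (e : nat -> H) n q : q != 0 ->
  (forall x, in_span e n (q *: x)) ->
  indep (fun i => phi1 (e i)) n -> indep (fun i => phi2 (e i)) n ->
  complete w1 -> complete w2 ->
  exists C, forall x, x \notin @torsion A H -> C <= height x.
Proof.
move=> q0 hq en1 en2 c1 c2.
have [C1 hC1] := norm_controls_coef N1 c1 en1.
have [C2 hC2] := norm_controls_coef N2 c2 en2.
have iq1 : iota1 q != 0 by rewrite -(rmorph0 iota1) (inj_eq iota1_inj).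
have iq2 : iota2 q != 0 by rewrite -(rmorph0 iota2) (inj_eq iota2_inj).
exists (w1 (iota1 q) + w2 (iota2 q) - C1 - C2) => x xt; have [c cE] := hq x.
have [i [lti ci]] : exists i, (i < n)%N /\ c i != 0.
  apply: contrapT => no; move/negP: xt; apply; apply/asboolP; exists q => //.
  rewrite cE big1 // => i _; have [->|ci] := eqVneq (c i) 0; first by rewrite scale0r.
  by exfalso; apply: no; exists i.
have ic1 : iota1 (c i) != 0 by rewrite -(rmorph0 iota1) (inj_eq iota1_inj).
have ic2 : iota2 (c i) != 0 by rewrite -(rmorph0 iota2) (inj_eq iota2_inj).
have b1 : ball_le N1 (N1 (phi1 x) - w1 (iota1 q)) (\sum_(i < n) iota1 (c i) *: phi1 (e i)).
  rewrite -phi_sum -cE linearZ /=.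
  by apply: ball_leZ; [exact: ball_le_norm|exact: ord_ge_refl].
have b2 : ball_le N2 (N2 (phi2 x) - w2 (iota2 q)) (\sum_(i < n) iota2 (c i) *: phi2 (e i)).
  rewrite -phi_sum -cE linearZ /=.
  by apply: ball_leZ; [exact: ball_le_norm|exact: ord_ge_refl].
have := hC1 (fun i => iota1 (c i)) _ b1 i lti; rewrite ord_ge_nz // => h1.
have := hC2 (fun i => iota2 (c i)) _ b2 i lti; rewrite ord_ge_nz // => h2.
have h3 := ord_sum_le0 ci; rewrite /height; lra.
Qed.

End OneSide.

(** * Norms with values in a discrete group *)

Section Cosets.
Context {R : realType} {F : fieldType} {w : valuation R F} {V : lmodType F}.
Variables (N : gauge w V) (Gamma : zmodClosed R).
Hypothesis ord_Gamma : forall a, a != 0 -> w a \in Gamma.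

(** The terms of a combination have pairwise distinct norms and cannot cancel. *)
Lemma distinct_cosets_indep (v : nat -> V) k :
  (forall i, (i < k)%N -> v i != 0) ->
  (forall i j, (i < j < k)%N -> N (v i) - N (v j) \notin Gamma) -> indep v k.
Proof.
move=> v0 vG c cs; suff : (forall i, (i < k)%N -> c i = 0) \/
    (\sum_(i < k) c i *: v i != 0 /\ exists i, [/\ (i < k)%N, c i != 0 &
      N (\sum_(i < k) c i *: v i) = N (v i) - w (c i)]).
  by case=> [//|[]]; rewrite cs eqxx.
elim: k v0 vG {cs} => [|k IHk] v0 vG; first by left.
have [|i j /andP[ij jk]|IH|[s0 [i [ik ci Ns]]]] := IHk.
- by move=> i ik; apply: v0; exact: leqW.
- by apply: vG; rewrite ij leqW.
- rewrite big_ord_recr big1 /= => [|i _]; last by rewrite IH // scale0r.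
  rewrite add0r; have [ck|ck] := eqVneq (c k) 0.
    by left=> i; rewrite ltnS leq_eqVlt => /predU1P[->|/IH].
  right; rewrite scaler_eq0 negb_or ck v0 //; split => //; exists k; split => //.
  by rewrite gnormZ // v0.
rewrite big_ord_recr /=; right; have [ck|ck] := eqVneq (c k) 0.
  by rewrite ck scale0r addr0; split => //; exists i; rewrite leqW.
have cvk : c k *: v k != 0 by rewrite scaler_eq0 negb_or ck v0.
have Nk : N (c k *: v k) = N (v k) - w (c k) by rewrite gnormZ // v0.
have [lt|gt|eq] := ltgtP (N (\sum_(i < k) c i *: v i)) (N (c k *: v k)).
- by have [? ->] := gnorm_max s0 cvk lt; split => //; exists k; split.
- by have [] := gnorm_max cvk s0 gt; rewrite addrC => ? ->; split => //; exists i; rewrite leqW.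
- exfalso; move: eq; rewrite Ns Nk => eq.
  have : N (v i) - N (v k) \notin Gamma by apply: vG; rewrite ik /=.
  rewrite (_ : _ - _ = w (c i) - w (c k)); last lra.
  by rewrite rpredB // ord_Gamma.
Qed.

(** On a finite-dimensional space the norm takes values in finitely many cosets of
    the value group. *)
Lemma finite_cosets (e : nat -> V) n : (forall v, in_span e n v) ->
  exists s : seq R, forall x, x != 0 -> exists2 c, c \in s & N x - c \in Gamma.
Proof.
move=> espan; apply: contrapT => /forallNP no.
suff /(_ n.+1)[v [v0 vG]] : forall k, exists v : nat -> V,
    (forall i, (i < k)%N -> v i != 0) /\
    (forall i j, (i < j < k)%N -> N (v i) - N (v j) \notin Gamma).
  have := indep_le_span (distinct_cosets_indep v0 vG) (y := e) (fun i _ => espan (v i)).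
  by rewrite ltnn.
elim=> [|k [v [v0 vG]]]; first by exists (fun=> 0); split => // i j; rewrite ltn0 andbF.
have /existsNP[x /not_implyP[x0 xs]] := no [seq N (v i) | i <- iota 0 k].
exists (fun i => if (i < k)%N then v i else x); split.
  by move=> i _; case: ifP => // /v0.
move=> i j /andP[ij]; rewrite ltnS leq_eqVlt => /predU1P[jk|jk].
  subst j; rewrite ij ltnn -opprB rpredN; apply: contra_notN xs => xG.
  by exists (N (v i)) => //; apply: map_f; rewrite mem_iota.
by rewrite jk (ltn_trans ij jk); apply: vG; rewrite ij.
Qed.

End Cosets.

Section DiscreteMinimum.
Context {R : realType} {T : Type} (Gamma : zmodClosed R) (f : T -> R).

Lemma discrete_gap : discrete_subgroup Gamma ->
  exists2 eps : R, 0 < eps & forall g, g \in Gamma -> `|g| < eps -> g = 0.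
Proof.
move=> /(_ 0 (rpred0 _)) [_ [U]]; rewrite /nbhs /= => -[eps eps0 sU] hU; exists eps => // g gG ge.
have : U g by apply: sU; rewrite /ball_ /= sub0r normrN.
by move=> Ug; have : (U `&` [set y : R | y \in Gamma]) g by []; rewrite hU.
Qed.

(** On a nonempty set P, a function bounded below with values in finitely many cosets
    of a discrete subgroup attains its minimum. *)
Lemma coset_minimum (s : seq R) (C : R) (P : T -> Prop) : discrete_subgroup Gamma ->
  (exists x, P x) -> (forall x, P x -> C <= f x) ->
  (forall x, P x -> exists2 c, c \in s & f x - c \in Gamma) ->
  exists2 x, P x & forall y, P y -> f x <= f y.
Proof.
move=> /discrete_gap[eps eps0 gap0].
elim: s P => [|c s IHs] P [x0 Px0] bnd cos; first by have [] := cos _ Px0.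
(* within one coset, a value within eps of the infimum is the minimum *)
have one : (exists x, P x /\ f x - c \in Gamma) ->
    exists2 x, P x & forall y, P y -> f y - c \in Gamma -> f x <= f y.
  move=> [x1 [Px1 x1G]]; pose E := [set f x | x in [set x | P x /\ f x - c \in Gamma]].
  have hE : has_inf E.
    split; first by exists (f x1); exists x1.
    by exists C => _ [y [Py _] <-]; exact: bnd.
  have [_ [x [Px xG] <-] xinf] := inf_adherent eps0 hE.
  exists x => // y Py yG; have [//|yx] := leP (f x) (f y).
  have iy : inf E <= f y by apply: ge_inf; [exact: hE.2|exists y].
  have : f x - f y = 0.
    apply: gap0; last by rewrite ger0_norm; lra.
    by rewrite (_ : _ - _ = (f x - c) - (f y - c)); [rewrite rpredB|lra].
  by move=> ?; lra.
pose P2 x := P x /\ f x - c \notin Gamma.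
have P2s x : P2 x -> exists2 c', c' \in s & f x - c' \in Gamma.
  move=> [Px nx]; have [c' + xc'] := cos _ Px; rewrite inE => /predU1P[e|]; last by exists c'.
  by move: nx; rewrite -e xc'.
have [h1|n1] := pselect (exists x, P x /\ f x - c \in Gamma); last first.
  have allP2 x : P x -> P2 x by move=> Px; split => //; apply/negP => xG; apply: n1; exists x.
  have [||x [Px _] xmin] := IHs P2 _ _ P2s; first by exists x0; exact: allP2.
    by move=> x [Px _]; exact: bnd.
  by exists x => // y /allP2; exact: xmin.
have [x1 Px1 x1min] := one h1.
have [h2|n2] := pselect (exists x, P2 x); last first.
  exists x1 => // y Py; apply: x1min => //.
  by apply: contrapT => /negP ny; apply: n2; exists y.
have [|x2 [Px2 _] x2min] := IHs P2 h2 _ P2s; first by move=> x [Px _]; exact: bnd.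
have [le|/ltW le] := leP (f x1) (f x2).
  exists x1 => // y Py; have [|ny] := boolP (f y - c \in Gamma); first exact: x1min.
  by apply: le_trans le _; exact: x2min.
exists x2 => // y Py; have [yG|ny] := boolP (f y - c \in Gamma); last exact: x2min.
by apply: le_trans le _; exact: x1min.
Qed.

End DiscreteMinimum.

(** * Hall's theorem and changes of basis *)

Section Hall.
Variables (T : finType) (E : rel T).

(** E is read as a bipartite graph between two copies of T. *)
Definition neighbours (S : {set T}) : {set T} := [set u | [exists t in S, E t u]].

Lemma neighboursU S S' : neighbours (S :|: S') = neighbours S :|: neighbours S'.
Proof.
apply/setP => u; rewrite !inE; apply/existsP/orP => [[t]|].
  by rewrite inE => /andP[/orP[tS|tS'] tu]; [left|right]; apply/existsP; exists t; apply/andP.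
by case=> /existsP[t /andP[tS tu]]; exists t; rewrite inE tS ?orbT.
Qed.

(* Hall's theorem for the subgraph induced by X on one side and Y on the other *)
Let hall_rec n : forall X Y : {set T}, (#|X| <= n)%N ->
  (forall S : {set T}, S \subset X -> (#|S| <= #|neighbours S :&: Y|)%N) ->
  exists f : T -> T, {in X &, injective f} /\
    forall t, t \in X -> E t (f t) /\ f t \in Y.
Proof.
elim: n => [|n IHn] X Y.
  rewrite leqn0 cards_eq0 => /eqP -> _.
  by exists id; split => [t t'|t]; rewrite inE.
move=> Xn hX; have [->|[x xX]] := set_0Vmem X.
  by exists id; split => [t t'|t]; rewrite inE.
have [/existsP[S /and4P[SX S0 XS /eqP eS]]|noS] :=
    boolP [exists S : {set T}, [&& S \subset X, S != finset.set0, ~~ (X \subset S) &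
      #|neighbours S :&: Y| == #|S|]].
  (* S has exactly as many neighbours as elements: match S, then the rest *)
  have S_lt : (#|S| < #|X|)%N by apply: proper_card; rewrite properE SX.
  have [|S' S'S|f1 [f1_inj f1P]] := IHn S Y.
  - by rewrite -ltnS (leq_trans S_lt).
  - by apply: hX; exact: fintype.subset_trans S'S SX.
  have cXS : #|X :\: S| = (#|X| - #|S|)%N by rewrite cardsD (finset.setIidPr SX).
  have [|S' S'X|f2 [f2_inj f2P]] := IHn (X :\: S) (Y :\: neighbours S).
  - rewrite cXS leq_subLR; apply: leq_trans Xn _; rewrite -add1n leq_add2r.
    by rewrite card_gt0.
  - have dis : S :&: S' = finset.set0.
      apply/finset.setP => u; rewrite !inE; apply/negP => /andP[uS uS'].
      by have := fintype.subsetP S'X _ uS'; rewrite !inE uS.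
    have := hX (S :|: S'); rewrite finset.subUset SX (fintype.subset_trans S'X (finset.subsetDl _ _)) => /(_ isT).
    rewrite cardsU dis cards0 subn0 neighboursU finset.setIUl => le1.
    rewrite -(leq_add2l #|S|); apply: leq_trans le1 _; rewrite -eS.
    apply: leq_trans (leq_card_setU _ _); apply: subset_leq_card.
    apply/fintype.subsetP => u.
    rewrite !(finset.in_setU, finset.in_setI, finset.in_setD).
    by case: (u \in neighbours S); case: (u \in neighbours S'); case: (u \in Y).
  have f2n t : t \in X -> t \notin S -> f2 t \notin neighbours S.
    move=> tX tS; have [|_] := f2P t; first by rewrite !inE tS.
    by rewrite finset.in_setD => /andP[].
  have f1n t : t \in S -> f1 t \in neighbours S.
    by move=> tS; rewrite inE; apply/existsP; exists t; rewrite tS; have [] := f1P _ tS.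
  exists (fun t => if t \in S then f1 t else f2 t); split.
    move=> t t' tX t'X; case: ifPn => tS; case: ifPn => t'S.
    - exact: f1_inj.
    - by move=> e; have := f2n _ t'X t'S; rewrite -e f1n.
    - by move=> e; have := f2n _ tX tS; rewrite e f1n.
    - by apply: f2_inj; rewrite inE ?tS ?t'S.
  move=> t tX; case: ifPn => tS; first exact: f1P.
  by have [|? +] := f2P t; rewrite !inE ?tS // => /andP[].
(* every proper nonempty subset has a spare neighbour: match x arbitrarily *)
have [y] : exists y, y \in neighbours [set x]%SET :&: Y.
  by apply/finset.set0Pn; rewrite -card_gt0 (leq_trans _ (hX [set x]%SET _)) ?cards1 ?finset.sub1set.
rewrite !inE => /andP[/existsP[x' /andP[]]]; rewrite inE => /eqP -> Exy yY.
have [|S SX|f [f_inj fP]] := IHn (X :\ x) (Y :\ y).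
- by rewrite -ltnS (leq_trans _ Xn) // [X in (_ < X)%N](cardsD1 x) xX.
- have [->|S0] := eqVneq S finset.set0; first by rewrite cards0.
  have SX' : S \subset X by apply: fintype.subset_trans SX (finset.subsetDl _ _).
  have lt : (#|S| < #|neighbours S :&: Y|)%N.
    rewrite ltn_neqAle hX // andbT eq_sym; apply: contraNN noS => eS.
    apply/existsP; exists S; rewrite SX' S0 eS andbT /=.
    apply: contraTN SX => XS; apply/negP => /fintype.subsetP /(_ x).
    by rewrite (fintype.subsetP XS) // => /(_ isT); rewrite !inE eqxx.
  rewrite finset.setIDA; move: lt; rewrite [X in (_ < X)%N](cardsD1 y).
  by case: (y \in _) => //=; rewrite add0n => /ltnW.
exists (fun t => if t == x then y else f t); split.
  move=> t t' tX t'X; have [->|tx] := eqVneq t x; have [->//|t'x] := eqVneq t' x.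
  - have [|_] := fP t'; first by rewrite !inE t'x.
    by rewrite !inE => /andP[/eqP nfy _] e; rewrite -e in nfy.
  - have [|_] := fP t; first by rewrite !inE tx.
    by rewrite !inE => /andP[/eqP nfy _] e; rewrite e in nfy.
  - by apply: f_inj; rewrite !inE ?tx ?t'x.
move=> t tX; have [->|tx] := eqVneq t x; first by split.
by have [|? +] := fP t; rewrite !inE ?tx // => /andP[].
Qed.

Theorem hall_marriage :
  (forall S : {set T}, (#|S| <= #|neighbours S|)%N) ->
  exists2 f : T -> T, injective f & forall t, E t (f t).
Proof.
move=> h; have [|S _|f [f_inj fP]] := @hall_rec #|T| [set: T]%SET [set: T]%SET.
- by rewrite cardsT.
- by rewrite finset.setIT.
exists f => [t t'|t]; first by apply: f_inj; rewrite inE.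
by have [] := fP t (finset.in_setT t).
Qed.

(** Let D be a left inverse of C such that any two composable nonzero entries
    C j i and D i' j, with h i <= h i', have j adjacent to i or to i'. For a set S of
    indices, the part of D C that factors through the neighbours of S is then
    unitriangular on S for the order by h, so that S has at least as many
    neighbours as elements. *)
Lemma matching_of_inverse (R : realType) (F : fieldType) (h : T -> R) (C D : T -> T -> F) :
  (forall i i', \sum_j D i' j * C j i = (i' == i)%:R) ->
  (forall i i' j, C j i != 0 -> D i' j != 0 -> h i <= h i' -> E i j \/ E i' j) ->
  exists2 f : T -> T, injective f & forall t, E t (f t).
Proof.
move=> DC CDE; apply: hall_marriage => S; pose J := neighbours S.
pose X : 'M[F]_(#|S|, #|J|) := \matrix_(i, j) C (enum_val j) (enum_val i).
suff kX : kermx X = 0.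
  have := mxrank_ker X; rewrite kX mxrank0 => /esym/eqP; rewrite subn_eq0.
  by move/leq_trans; apply; exact: rank_leq_col.
apply/row_matrixP => k; rewrite row0; apply/rowP => i0; rewrite [RHS]mxE.
set c := row k (kermx X); have cX : c *m X = 0 by rewrite -row_mul mulmx_ker row0.
apply: contrapT => /eqP ci0.
(* a vector c in the kernel vanishes: look at an index m of its support where h is
   the largest *)
have [m cm mmax] := @Order.TotalTheory.arg_maxP _ R _ i0 (fun i => c 0 i != 0)
  (fun i => h (enum_val i)) ci0.
move/eqP: (cm); apply.
have E0 : \sum_(i < #|S|) c 0 i * \sum_(j in J) D (enum_val m) j * C j (enum_val i) = 0.
  under eq_bigr do rewrite mulr_sumr; rewrite exchange_big big1 //= => j jJ.
  under eq_bigr do rewrite mulrCA; rewrite -mulr_sumr.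
  rewrite (_ : \sum_i _ = 0) ?mulr0 //.
  have := congr1 (fun M : 'rV_#|J| => M 0 (enum_rank_in jJ j)) cX.
  rewrite [X in X = _]mxE [X in _ = X]mxE => Xj; rewrite -[RHS]Xj.
  by apply: eq_bigr => i _; congr (_ * _); rewrite [RHS]mxE enum_rankK_in.
have part i : c 0 i != 0 ->
    \sum_(j in J) D (enum_val m) j * C j (enum_val i) = (enum_val m == enum_val i)%:R.
  move=> ci; rewrite -DC [RHS](bigID [in J]) /= [X in _ = _ + X]big1 ?addr0 // => j nJ.
  apply: contraNeq nJ; rewrite mulf_eq0 negb_or => /andP[Dn Cn]; rewrite inE; apply/existsP.
  have [Ei|Em] := CDE _ _ _ Cn Dn (mmax _ ci).
    by exists (enum_val i); rewrite enum_valP.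
  by exists (enum_val m); rewrite enum_valP.
rewrite -[RHS]E0 (bigD1 m) //= part ?eqxx ?mulr1 //.
rewrite [X in _ = _ + X]big1 ?addr0 // => i im.
have [->|ci] := eqVneq (c 0 i) 0; first by rewrite mul0r.
by rewrite part // (inj_eq enum_val_inj) eq_sym (negbTE im) mulr0.
Qed.

End Hall.

(** * Elements of a multiset *)

Section MultisetElements.
Variables (T : choiceType) (n : nat) (f : 'I_n -> T).

Lemma inj_surj_bijective (U W : Type) (g : U -> W) :
  injective g -> (forall y, exists x, g x = y) -> bijective g.
Proof.
move=> gi /choice[g' g'P]; exists g' => // x; exact: gi.
Qed.

(** The copies of a value v are numbered by the positions at which f takes it. *)
Lemma mset_elt_enum : exists2 b : 'I_n -> mset_elt (seq_mset [seq f i | i <- enum 'I_n]),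
  bijective b & forall i, mset_val (b i) = f i.
Proof.
pose L v := [seq k <- enum 'I_n | f k == v].
have LE v : (seq_mset [seq f i | i <- enum 'I_n]) v = size (L v).
  by rewrite mset_seqE count_map size_filter.
have Li i : i \in L (f i) by rewrite mem_filter eqxx mem_enum.
have bP i : (((f i, index i (L (f i))) : T * nat).2 <
    (seq_mset [seq f i | i <- enum 'I_n]) (f i, index i (L (f i))).1)%N.
  by rewrite /= LE index_mem.
exists (fun i => exist _ (f i, index i (L (f i))) (bP i)) => //.
apply: inj_surj_bijective => [i j [fij]|[[v m] mP]].
  by rewrite -fij => e; rewrite -[i](nth_index i (Li i)) e nth_index // fij.
have ltm : (m < size (L v))%N by rewrite -LE.
have i0 : 'I_n by case: (L v) ltm => [//|i0 _ _].
have uL : uniq (L v) by rewrite filter_uniq // enum_uniq.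
exists (nth i0 (L v) m); apply: eq_exist => /=.
have : nth i0 (L v) m \in L v by exact: mem_nth.
by rewrite mem_filter => /andP[/eqP -> _]; rewrite index_uniq.
Qed.

End MultisetElements.

(** * Stability of doubly-orthogonal bases *)

Section Stability.
Context {R : realType} {A : idomainType} {F1 F2 : fieldType}.
Context {iota1 : {rmorphism A -> F1}} {iota2 : {rmorphism A -> F2}}.
Context {w1 : valuation R F1} {w2 : valuation R F2}.
Context {H : lmodType A} {V1 : lmodType F1} {V2 : lmodType F2}.
Context {phi1 : {linear H -> V1 | iota1 \; *:%R}}.
Context {phi2 : {linear H -> V2 | iota2 \; *:%R}}.
Hypothesis iota1_inj : injective iota1.
Hypothesis iota2_inj : injective iota2.
Hypothesis phi1_neq0 : forall x, x \notin @torsion A H -> phi1 x != 0.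
Hypothesis phi2_neq0 : forall x, x \notin @torsion A H -> phi2 x != 0.
Hypothesis ord_sum_le0 : forall a, a != 0 -> w1 (iota1 a) + w2 (iota2 a) <= 0.
Variables (Gamma : zmodClosed R) (t : R) (d : nat).
Hypothesis ord_Gamma : forall a, a != 0 -> w1 (iota1 a) \in Gamma.

(** If e' j occurs in the expansion of x with a coefficient of order w at the first
    place, the pair of norms of e' j, lowered by w at the first place and raised by w
    at the second, is bounded by the pair of norms of x, up to t. *)
Lemma expansion_bound (N1 N1' : gauge w1 V1) (N2 N2' : gauge w2 V2) (e' : nat -> H)
    (c : nat -> A) (x : H) j :
  (forall v, v != 0 -> N1' v <= N1 v + t) -> (forall v, v != 0 -> N2' v <= N2 v + t) ->
  orthogonal_family N1' (fun i => phi1 (e' i)) d ->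
  orthogonal_family N2' (fun i => phi2 (e' i)) d ->
  (forall i, (i < d)%N -> e' i \notin @torsion A H) ->
  x \notin @torsion A H -> x - \sum_(i < d) c i *: e' i \in @torsion A H ->
  (j < d)%N -> c j != 0 ->
  N1' (phi1 (e' j)) - w1 (iota1 (c j)) <= N1 (phi1 x) + t /\
  N2' (phi2 (e' j)) + w1 (iota1 (c j)) <= N2 (phi2 x) + t.
Proof.
move=> N1t N2t o1 o2 e't xt xc ltj cj.
have ic1 : iota1 (c j) != 0 by rewrite -(rmorph0 iota1) (inj_eq iota1_inj).
have ic2 : iota2 (c j) != 0 by rewrite -(rmorph0 iota2) (inj_eq iota2_inj).
have e1 : phi1 x = \sum_(i < d) iota1 (c i) *: phi1 (e' i).
  apply/eqP; rewrite -subr_eq0 -phi_sum -raddfB; apply/eqP.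
  exact: (phi_torsion iota1_inj).
have e2 : phi2 x = \sum_(i < d) iota2 (c i) *: phi2 (e' i).
  apply/eqP; rewrite -subr_eq0 -phi_sum -raddfB; apply/eqP.
  exact: (phi_torsion iota2_inj).
have b1 : ball_le N1' (N1' (phi1 x)) (\sum_(i < d) iota1 (c i) *: phi1 (e' i)).
  by rewrite -e1 ball_le_norm.
have b2 : ball_le N2' (N2' (phi2 x)) (\sum_(i < d) iota2 (c i) *: phi2 (e' i)).
  by rewrite -e2 ball_le_norm.
have n1 := N1t _ (phi1_neq0 xt); have n2 := N2t _ (phi2_neq0 xt).
have p1 := phi1_neq0 (e't j ltj); have p2 := phi2_neq0 (e't j ltj).
have := o1 (fun i => iota1 (c i)) _ b1 j ltj.
rewrite ball_le_nz ?gnormZ ?scaler_eq0 ?negb_or ?ic1 ?p1 // => h1.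
have := o2 (fun i => iota2 (c i)) _ b2 j ltj.
rewrite ball_le_nz ?gnormZ ?scaler_eq0 ?negb_or ?ic2 ?p2 // => h2.
by have h3 := ord_sum_le0 cj; split; lra.
Qed.

(** Two doubly-orthogonal bases for norms at distance at most t are matched. A
    nonzero entry of the change of basis bounds the pair of norms of e' j by that of
    e i up to t, and one of the inverse change bounds the pair of e i' by that of
    e' j; when the height of e i' is not less than that of e i, these bounds force
    e' j to be within t of e i or of e i'. *)
Theorem spectra_matching (N1 N1' : gauge w1 V1) (N2 N2' : gauge w2 V2) (e e' : nat -> H) :
  (forall v, v != 0 -> `|N1' v - N1 v| <= t) ->
  (forall v, v != 0 -> `|N2' v - N2 v| <= t) ->
  orthogonal_family N1 (fun i => phi1 (e i)) d ->
  orthogonal_family N2 (fun i => phi2 (e i)) d ->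
  orthogonal_family N1' (fun i => phi1 (e' i)) d ->
  orthogonal_family N2' (fun i => phi2 (e' i)) d ->
  indep e d -> indep e' d ->
  (forall v, in_span (fun i => to_mod_torsion (e i)) d v) ->
  (forall v, in_span (fun i => to_mod_torsion (e' i)) d v) ->
  exists2 f : 'I_d -> 'I_d, injective f & forall i, exists2 g, g \in Gamma &
    `|N1' (phi1 (e' (f i))) + g - N1 (phi1 (e i))| <= t /\
    `|N2' (phi2 (e' (f i))) - g - N2 (phi2 (e i))| <= t.
Proof.
move=> N1t N2t o1 o2 o1' o2' ed ed' es es'.
have et i : (i < d)%N -> e i \notin @torsion A H by exact: nontorsion_indep.
have et' i : (i < d)%N -> e' i \notin @torsion A H by exact: nontorsion_indep.
have /choice[C CP] : forall i, exists c : nat -> A,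
    to_mod_torsion (e i) = \sum_(j < d) c j *: to_mod_torsion (e' j) by move=> i; exact: es'.
have /choice[D DP] : forall j, exists c : nat -> A,
    to_mod_torsion (e' j) = \sum_(i < d) c i *: to_mod_torsion (e i) by move=> i; exact: es.
pose E (i j : 'I_d) := `[< exists2 g, g \in Gamma &
    `|N1' (phi1 (e' j)) + g - N1 (phi1 (e i))| <= t /\
    `|N2' (phi2 (e' j)) - g - N2 (phi2 (e i))| <= t >].
suff [f f_inj fE] : exists2 f : 'I_d -> 'I_d, injective f & forall i, E i (f i).
  by exists f => // i; have /asboolP := fE i.
apply: (@matching_of_inverse _ E R F1 (fun i : 'I_d => N1 (phi1 (e i)) + N2 (phi2 (e i)))
  (fun j i : 'I_d => iota1 (C i j)) (fun i j : 'I_d => iota1 (D j i))) => [i i'|i i' j].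
  under eq_bigr do rewrite -rmorphM; rewrite -rmorph_sum -(rmorph_nat iota1); congr (iota1 _).
  have S := sum_indicator (fun k => to_mod_torsion (e k)) 1 (ltn_ord i).
  have eqS : \sum_(k < d) (\sum_(j < d) D j k * C i j) *: to_mod_torsion (e k) =
      \sum_(k < d) (if (k : nat) == i then 1 else 0) *: to_mod_torsion (e k).
    rewrite S scale1r CP; under eq_bigr do rewrite scaler_suml.
    rewrite exchange_big /=; apply: eq_bigr => j _; rewrite DP scaler_sumr.
    by apply: eq_bigr => k _; rewrite mulrC scalerA.
  rewrite (@indep_coef _ _ _ d (fun k => \sum_(j < d) D j k * C i j)
    (fun k => if k == i then 1 else 0) (indep_mod_torsion ed) eqS i' (ltn_ord i')).
  by rewrite -val_eqE /=; case: eqP.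
rewrite -!(rmorph0 iota1) !(inj_eq iota1_inj) => Cn Dn hle.
have up1 v : v != 0 -> N1' v <= N1 v + t by move=> /N1t; rewrite ler_norml => /andP[]; lra.
have up2 v : v != 0 -> N2' v <= N2 v + t by move=> /N2t; rewrite ler_norml => /andP[]; lra.
have dn1 v : v != 0 -> N1 v <= N1' v + t by move=> /N1t; rewrite ler_norml => /andP[]; lra.
have dn2 v : v != 0 -> N2 v <= N2' v + t by move=> /N2t; rewrite ler_norml => /andP[]; lra.
have [p1 p2] := expansion_bound up1 up2 o1' o2' et' (et i (ltn_ord i))
  ((mod_torsion_spanP _ _ _ _).2 (CP i)) (ltn_ord j) Cn.
have [q1 q2] := expansion_bound dn1 dn2 o1 o2 et (et' j (ltn_ord j))
  ((mod_torsion_spanP _ _ _ _).2 (DP j)) (ltn_ord i') Dn.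
set g := w1 (iota1 (C i j)) in p1 p2; set g' := w1 (iota1 (D j i')) in q1 q2.
have [/andP[m1 m2]|nm] := boolP ((`|N1' (phi1 (e' j)) - g - N1 (phi1 (e i))| <= t) &&
    (`|N2' (phi2 (e' j)) + g - N2 (phi2 (e i))| <= t)).
  left; apply/asboolP; exists (- g); first by rewrite rpredN ord_Gamma.
  by rewrite opprK.
right; apply/asboolP; exists g'; first by rewrite ord_Gamma.
move: nm; rewrite negb_and !ler_norml !negb_and -!ltNge => nm.
by case/orP: nm => /orP[] nm; split; apply/andP; split; lra.
Qed.

End Stability.

(** * The valuations of the Novikov fields *)

Section NovikovValuations.
Context (R : realType) (K : fieldType) (Gamma : zmodClosed R).
Local Notation L := (group_algebra K Gamma).
Local Notation Lup := (novikov_up K Gamma).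
Local Notation Ldn := (novikov_down K Gamma).

(** the lowest exponent of a nonzero upward series *)
Definition up_ord (f : Lup) : R := fine (nu_up f).

Lemma up_ordP (f : Lup) : f != 0 ->
  f (up_ord f) != 0 /\ forall g, f g != 0 -> up_ord f <= g.
Proof. by move=> /nu_upP[m [e fm mP]]; rewrite /up_ord e. Qed.

Lemma up_ord_eq (f : Lup) m : f m != 0 -> (forall g, f g != 0 -> m <= g) -> up_ord f = m.
Proof.
move=> fm mP; have f0 : f != 0 by apply: contraNneq fm => ->.
have [fo oP] := up_ordP f0; apply/eqP; rewrite eq_le mP // andbT; exact: oP.
Qed.

Fact up_ordM (a b : Lup) : a != 0 -> b != 0 -> up_ord (a * b) = up_ord a + up_ord b.
Proof.
move=> /up_ordP[am aP] /up_ordP[bn bP]; apply: up_ord_eq; last first.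
  exact: (up_geM aP bP).
rewrite coefME (@convE _ _ _ _ _ _ _ [:: up_ord a]) //.
  by rewrite big_seq1 mulf_neq0 // addrC addKr.
move=> x /aP ax /bP bx; rewrite inE; apply/eqP; lra.
Qed.

Fact up_ordD (a b : Lup) : a != 0 -> b != 0 -> a + b != 0 ->
  Num.min (up_ord a) (up_ord b) <= up_ord (a + b).
Proof.
move=> /up_ordP[_ aP] /up_ordP[_ bP] /up_ordP[abm _].
by rewrite ge_min; case: (add_supp abm) => [/aP ->|/bP ->]; rewrite ?orbT.
Qed.

Definition up_valuation : valuation R Lup := Valuation up_ordM up_ordD.

Lemma up_ord_geP c (f : Lup) : ord_ge up_valuation c f <-> forall g, f g != 0 -> c <= g.
Proof.
rewrite /ord_ge; have [->|f0] := eqVneq f 0; first by split => // _ g; rewrite eqxx.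
have [fm fP] := up_ordP f0; split => [/= cf g /fP|/(_ _ fm)] //; exact: le_trans.
Qed.

Lemma up_ord_gt (f : Lup) c : (forall g, f g != 0 -> c < g) -> ord_gt up_valuation c f.
Proof.
move=> h; rewrite /ord_gt; have [//|f0] := eqVneq f 0.
by have [fm _] := up_ordP f0; exact: h.
Qed.

(** the opposite of the highest exponent of a nonzero downward series *)
Definition down_ord (f : Ldn) : R := up_ord (reflect_down f).

Lemma reflect_downM (a b : Ldn) : reflect_down (a * b) = reflect_down a * reflect_down b :> Lup.
Proof.
have rK (f : Ldn) : reflect_up (reflect_down f) = f.
  by apply: coef_inj => x /=; rewrite opprK.
rewrite -{1}(rK a) -{1}(rK b) -[reflect_up _ * reflect_up _]reflect_upM.
by apply: coef_inj => x; change ((reflect_down a * reflect_down b : Lup) (- - x) =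
  (reflect_down a * reflect_down b : Lup) x); rewrite opprK.
Qed.

Lemma reflect_downD (a b : Ldn) : reflect_down (a + b) = reflect_down a + reflect_down b :> Lup.
Proof. exact: coef_inj. Qed.

Lemma reflect_down_eq0 (a : Ldn) : (reflect_down a == 0 :> Lup) = (a == 0).
Proof.
apply/eqP/eqP => [e|->]; apply: coef_inj => x //.
by have := congr1 (fun u : Lup => u (- x)) e; rewrite /= opprK.
Qed.

Fact down_ordM (a b : Ldn) : a != 0 -> b != 0 -> down_ord (a * b) = down_ord a + down_ord b.
Proof. by move=> a0 b0; rewrite /down_ord reflect_downM up_ordM ?reflect_down_eq0. Qed.

Fact down_ordD (a b : Ldn) : a != 0 -> b != 0 -> a + b != 0 ->
  Num.min (down_ord a) (down_ord b) <= down_ord (a + b).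
Proof.
move=> a0 b0 ab0; rewrite /down_ord reflect_downD up_ordD ?reflect_down_eq0 //.
by rewrite -reflect_downD reflect_down_eq0.
Qed.

Definition down_valuation : valuation R Ldn := Valuation down_ordM down_ordD.

Lemma down_ordE (f : Ldn) : f != 0 -> nu_down f = (- down_ord f)%:E.
Proof.
move=> /nu_downP[m [-> fm mP]]; congr (_%:E); rewrite /down_ord (@up_ord_eq _ (- m)) ?opprK //.
  by rewrite /= opprK.
by move=> g /= /mP; rewrite lerNl.
Qed.

Lemma up_ordE (f : Lup) : f != 0 -> nu_up f = (up_ord f)%:E.
Proof. by move=> /nu_upP[m [e _ _]]; rewrite /up_ord e. Qed.

Lemma down_ord_geP c (f : Ldn) :
  ord_ge down_valuation c f <-> forall g, f g != 0 -> g <= - c.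
Proof.
rewrite /ord_ge /= -reflect_down_eq0; apply: iff_trans (up_ord_geP c _) _.
split=> h g fg; first by rewrite lerNr; apply: h; rewrite /= opprK.
by rewrite -[g]opprK lerNr; exact: h.
Qed.

Lemma down_ord_gt (f : Ldn) c : (forall g, f g != 0 -> g < - c) -> ord_gt down_valuation c f.
Proof.
move=> h; rewrite /ord_gt /= -reflect_down_eq0; apply: up_ord_gt => g /h.
by rewrite ltrNr opprK.
Qed.

(** The coefficient at g of the k-th term does not depend on k once k > g. *)
Lemma up_complete : complete up_valuation.
Proof.
move=> f fk; pose m (g : R) := (Num.truncn g).+1.
have stable g i j : g < i%:R -> (i <= j)%N -> f j g = f i g.
  move=> gi /subnKC <-; elim: (j - i)%N => [|k IHk]; first by rewrite addn0.
  rewrite addnS -IHk; apply/eqP; rewrite -subr_eq0; apply: contraTT gi => nz.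
  rewrite -leNgt; apply: le_trans ((up_ord_geP _ _).1 (fk (i + k)%N) g nz).
  by rewrite ler_nat leq_addr.
have mlt g : g < (m g)%:R by exact: truncnS_gt.
have limE g i : g < i%:R -> f (m g) g = f i g.
  by move=> gi; case: (leqP i (m g)) => [/stable ->//|/ltnW/stable <-].
have lG g : f (m g) g != 0 -> g \in Gamma by exact: coef_Gamma.
have ladm : admissible Upward [set g | f (m g) g != 0].
  move=> C; apply: sub_finite_set (coef_admissible (f (m C)) C) => g [/= lg gC].
  by split => //=; rewrite -(limE g) // (lt_trans gC) // mlt.
exists (Series lG ladm : Lup) => k; apply/up_ord_geP => g; apply: contraNT; rewrite -ltNge => gk.
by rewrite coefDE coefNE /= (limE g k gk) subrr.
Qed.

Lemma down_complete : complete down_valuation.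
Proof.
move=> f fk; have [|l lP] := up_complete (f := fun k => reflect_down (f k)).
  move=> k; apply/up_ord_geP => g nz; rewrite -[g]opprK lerNr.
  exact: ((down_ord_geP _ _).1 (fk k)).
exists (reflect_up l : Ldn) => k; apply/down_ord_geP => g nz; rewrite lerNr.
by apply: ((up_ord_geP _ _).1 (lP k)); rewrite /= opprK.
Qed.

Lemma up_truncation : truncation (@to_up R K Gamma) (@to_down R K Gamma)
  up_valuation down_valuation.
Proof.
move=> l k; pose p g := if g <= k then l g else 0.
have pG g : p g != 0 -> g \in Gamma.
  by rewrite /p; case: ifP => _; [exact: coef_Gamma|rewrite eqxx].
have padm : admissible Defs.Finite [set g | p g != 0].
  apply: sub_finite_set (coef_admissible l (k + 1)) => g /=; rewrite /p.
  by case: ifP => [gk lg|_]; [split => //=; lra|rewrite eqxx].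
exists (Series pG padm : L); split.
  apply: up_ord_gt => g; rewrite coefDE coefNE /= /p.
  by case: leP => //; rewrite subrr eqxx.
apply/down_ord_geP => g /=; rewrite /p opprK; case: ifP => //; by rewrite eqxx.
Qed.

Lemma down_truncation : truncation (@to_down R K Gamma) (@to_up R K Gamma)
  down_valuation up_valuation.
Proof.
move=> l k; pose p g := if - k <= g then l g else 0.
have pG g : p g != 0 -> g \in Gamma.
  by rewrite /p; case: ifP => _; [exact: coef_Gamma|rewrite eqxx].
have padm : admissible Defs.Finite [set g | p g != 0].
  apply: sub_finite_set (coef_admissible l (k + 1)) => g /=; rewrite /p.
  by case: ifP => [gk lg|_]; [split => //=; lra|rewrite eqxx].
exists (Series pG padm : L); split.
  apply: down_ord_gt => g; rewrite coefDE coefNE /= /p.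
  by case: leP => //; rewrite subrr eqxx.
apply/up_ord_geP => g /=; rewrite /p; case: ifP => //; by rewrite eqxx.
Qed.

Lemma to_up_inj : injective (@to_up R K Gamma). Proof. exact: embed_inj. Qed.
Lemma to_down_inj : injective (@to_down R K Gamma). Proof. exact: embed_inj. Qed.

Lemma up_down_ord_le0 (a : L) : a != 0 ->
  up_valuation (to_up a) + down_valuation (to_down a) <= 0.
Proof.
move=> /series_neq0[g ag].
have := (up_ord_geP _ (to_up a)).1 (ord_ge_refl up_valuation _) g ag.
have := (down_ord_geP _ (to_down a)).1 (ord_ge_refl down_valuation _) g ag.
by move=> ? ?; lra.
Qed.

Lemma up_ord_Gamma (f : Lup) : f != 0 -> up_valuation f \in Gamma.
Proof. by move=> /up_ordP[fm _]; exact: coef_Gamma fm. Qed.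

Lemma down_ord_Gamma (f : Ldn) : f != 0 -> down_valuation f \in Gamma.
Proof. by rewrite -reflect_down_eq0 => /up_ord_Gamma. Qed.

End NovikovValuations.

(** * The norms of a filtered matched pair *)

Section NormGauges.
Context {R : realType} {K : fieldType} {Gamma : zmodClosed R}.
Local Notation Lup := (novikov_up K Gamma).
Local Notation Ldn := (novikov_down K Gamma).
Local Notation wup := (@up_valuation R K Gamma).
Local Notation wdn := (@down_valuation R K Gamma).

Section Up.
Variables (V : vectType Lup) (rho : up_norm V).

Lemma up_rhoE x : x != 0 -> rho x = (fine (rho x))%:E.
Proof.
move=> x0; rewrite fineK // fin_numE up_rho_npinfty andbT.
by apply: contra_neq x0 => /up_rho_eqNy.
Qed.

Fact up_gnormZ (a : Lup) x : a != 0 -> x != 0 -> fine (rho (a *: x)) = fine (rho x) - wup a.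
Proof. by move=> a0 x0; rewrite up_rhoZ (up_rhoE x0) up_ordE. Qed.

Fact up_gnormD x y : x != 0 -> y != 0 -> x + y != 0 ->
  fine (rho (x + y)) <= Num.max (fine (rho x)) (fine (rho y)).
Proof.
move=> x0 y0 xy0; have := up_rhoD rho x y.
by rewrite (up_rhoE x0) (up_rhoE y0) (up_rhoE xy0) -EFin_max lee_fin.
Qed.

(** the norm rho_up, made real-valued *)
Definition up_gauge : gauge wup V := Gauge up_gnormZ up_gnormD.

Lemma up_ballE r x : ball_le up_gauge r x = (rho x <= r%:E)%E.
Proof.
rewrite /ball_le; have [->|x0] := eqVneq x 0; last by rewrite (up_rhoE x0) lee_fin.
by rewrite (up_rho_eqNy rho 0).2 // leNye.
Qed.

Lemma up_orthogonalP n (x : nat -> V) :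
  up_orthogonal rho (fun i : 'I_n => x i) <-> orthogonal_family up_gauge x n.
Proof.
split=> [ho l r|ho a].
  rewrite up_ballE (ho (fun i : 'I_n => l i)) => h i lti; rewrite up_ballE up_rhoZ.
  by apply: le_trans h; rewrite (bigD1 (Ordinal lti)) //= le_max lexx.
under [RHS]eq_bigr do rewrite -up_rhoZ.
apply/le_anti/andP; split.
  elim/big_ind2: _ => [|x1 x2 y1 y2 h1 h2|//]; first by rewrite (up_rho_eqNy rho 0).2.
  apply: le_trans (up_rhoD _ _ _) _; rewrite ge_max !le_max h1 h2 orbT //.
elim/big_ind: _ => [|u v hu hv|i _]; [exact: leNye|by rewrite ge_max hu|].
have e : \sum_(j < n) extend a j *: x j = \sum_(j < n) a j *: x j.
  by apply: eq_bigr => j _; rewrite extendE.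
have oa r := ho (extend a) r; rewrite e in oa.
have [s0|s0] := eqVneq (\sum_(j < n) a j *: x j) 0.
  have -> : a i *: x i = 0.
    apply: (ball_le_all (N := up_gauge)) => k; rewrite -(extendE a); apply: oa => //.
    by rewrite s0 ball_le0.
  by rewrite s0.
rewrite (up_rhoE s0) -up_ballE -(extendE a); apply: oa => //.
by rewrite up_ballE -up_rhoE.
Qed.

End Up.

Section Down.
Variables (V : vectType Ldn) (rho : down_norm V).

Lemma down_rhoE x : x != 0 -> rho x = (fine (rho x))%:E.
Proof.
move=> x0; rewrite fineK // fin_numE down_rho_nninfty /=.
by apply: contra_neq x0 => /down_rho_eqy.
Qed.

Fact down_gnormZ (a : Ldn) x : a != 0 -> x != 0 ->
  - fine (rho (a *: x)) = - fine (rho x) - wdn a.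
Proof. by move=> a0 x0; rewrite down_rhoZ (down_rhoE x0) down_ordE //= opprK opprD. Qed.

Fact down_gnormD x y : x != 0 -> y != 0 -> x + y != 0 ->
  - fine (rho (x + y)) <= Num.max (- fine (rho x)) (- fine (rho y)).
Proof.
move=> x0 y0 xy0; have := down_rhoD rho x y.
rewrite (down_rhoE x0) (down_rhoE y0) (down_rhoE xy0) -EFin_min lee_fin.
by rewrite -oppr_min lerN2.
Qed.

(** the norm - rho_down, made real-valued *)
Definition down_gauge : gauge wdn V := Gauge down_gnormZ down_gnormD.

Lemma down_ballE r x : ball_le down_gauge r x = ((- r)%:E <= rho x)%E.
Proof.
rewrite /ball_le; have [->|x0] := eqVneq x 0; last by rewrite (down_rhoE x0) lee_fin lerNl.
by rewrite (down_rho_eqy rho 0).2 // leey.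
Qed.

Lemma down_orthogonalP n (x : nat -> V) :
  down_orthogonal rho (fun i : 'I_n => x i) <-> orthogonal_family down_gauge x n.
Proof.
split=> [ho l r|ho a].
  rewrite down_ballE (ho (fun i : 'I_n => l i)) => h i lti; rewrite down_ballE down_rhoZ.
  by apply: le_trans h _; rewrite (bigD1 (Ordinal lti)) //= ge_min lexx.
under [RHS]eq_bigr do rewrite -down_rhoZ.
apply/le_anti/andP; split; last first.
  elim/big_ind2: _ => [|x1 x2 y1 y2 h1 h2|//]; first by rewrite (down_rho_eqy rho 0).2.
  apply: le_trans (down_rhoD _ _ _); rewrite le_min !ge_min h1 h2 orbT //.
elim/big_ind: _ => [|u v hu hv|i _]; [exact: leey|by rewrite le_min hu|].
have e : \sum_(j < n) extend a j *: x j = \sum_(j < n) a j *: x j.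
  by apply: eq_bigr => j _; rewrite extendE.
have oa r := ho (extend a) r; rewrite e in oa.
have [s0|s0] := eqVneq (\sum_(j < n) a j *: x j) 0.
  have -> : a i *: x i = 0.
    apply: (ball_le_all (N := down_gauge)) => k; rewrite -(extendE a); apply: oa => //.
    by rewrite s0 ball_le0.
  by rewrite s0.
rewrite (down_rhoE s0) -[fine _]opprK -down_ballE -(extendE a); apply: oa => //.
by rewrite down_ballE opprK -down_rhoE.
Qed.

End Down.

Lemma basis_of_indep_span (F : fieldType) (V : vectType F) (x : nat -> V) n :
  indep x n -> (forall v, in_span x n v) -> basis_of fullv [tuple x i | i < n].
Proof.
move=> xi xs; apply/andP; split; last first.
  apply/freeP => k; under eq_bigr do rewrite nth_mktuple.
  by move/indepP: xi; exact.
rewrite eqEsubv subvf; apply/subvP => v _; have [c ->] := xs v.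
apply: memv_suml => i _; apply: memvZ; apply: memv_span.
by apply/tnthP; exists i; rewrite tnth_mktuple.
Qed.

End NormGauges.

(** * Gaps and doubly-orthogonal bases *)

Section MatchedPair.
Context {R : realType} {K : fieldType} {Gamma : zmodClosed R}.
Variables (B : matched_pair K Gamma) (d : nat) (rank_d : has_rank (mp_H B) d).
Local Notation H := (mp_H B).
Local Notation L := (group_algebra K Gamma).
Local Notation nontorsion x := (x \notin @torsion L H).

Lemma phi_up_indep (h : nat -> H) n : indep h n -> indep (fun i => phi_up B (h i)) n.
Proof. exact: (phi_indep (@to_up_inj _ _ _) (phi_up_iso B) (mp_H_fg B)). Qed.

Lemma phi_down_indep (h : nat -> H) n : indep h n -> indep (fun i => phi_down B (h i)) n.
Proof. exact: (phi_indep (@to_down_inj _ _ _) (phi_down_iso B) (mp_H_fg B)). Qed.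

Lemma phi_up_neq0 x : nontorsion x -> phi_up B x != 0.
Proof. exact: (phi_neq0 (@to_up_inj _ _ _) (phi_up_iso B) (mp_H_fg B)). Qed.

Lemma phi_down_neq0 x : nontorsion x -> phi_down B x != 0.
Proof. exact: (phi_neq0 (@to_down_inj _ _ _) (phi_down_iso B) (mp_H_fg B)). Qed.

Lemma exists_indep : exists h : nat -> H, indep h d.
Proof. by have [] := rank_spec (mp_H_fg B) rank_d. Qed.

Lemma spans_of_indep (h : nat -> H) : indep h d ->
  [/\ exists2 q : L, q != 0 & forall x, in_span h d (q *: x),
      forall v, in_span (fun i => phi_up B (h i)) d v &
      forall v, in_span (fun i => phi_down B (h i)) d v].
Proof.
move=> hd; have [_ hmax] := rank_spec (mp_H_fg B) rank_d.
have [hq u] := phi_span_of_indep (@to_up_inj _ _ _) (phi_up_iso B) (mp_H_fg B) hd hmax.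
by have [] := phi_span_of_indep (@to_down_inj _ _ _) (phi_down_iso B) (mp_H_fg B) hd hmax.
Qed.

Section Height.
Variables (rho_up : up_norm (mp_up B)) (rho_down : down_norm (mp_down B)).
Let P := FilteredMatchedPair rho_up rho_down.
Let ht (x : H) : R := @height _ _ _ _ _ _ _ _ _ _ _ (phi_up B) (phi_down B)
  (up_gauge rho_up) (down_gauge rho_down) x.

Lemma htE x : nontorsion x ->
  (rho_down (phi_down B x) - rho_up (phi_up B x) = (- ht x)%:E)%E.
Proof.
move=> xt; rewrite (down_rhoE _ (phi_down_neq0 xt)) (up_rhoE _ (phi_up_neq0 xt)).
by rewrite -EFinB /ht /height /=; congr (_%:E); lra.
Qed.

Lemma ht_bounded : exists C, forall x, nontorsion x -> C <= ht x.
Proof.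
have [h hd] := exists_indep; have [[q q0 hq] _ _] := spans_of_indep hd.
apply: (height_bounded_below (@to_up_inj _ _ _) (@to_down_inj _ _ _)
  (@up_down_ord_le0 _ _ _) _ _ q0 hq).
- exact: phi_up_indep.
- exact: phi_down_indep.
- exact: up_complete.
- exact: down_complete.
Qed.

Lemma gap_fin i : (1 <= i <= d)%N -> gap P i \is a fin_num.
Proof.
move=> /andP[i0 id]; have [C hC] := ht_bounded.
have [h hd] := exists_indep; have hi := indep_prefix id hd.
have ht0 j : (j < i)%N -> nontorsion (h j) by exact: nontorsion_indep hi.
apply/fin_numPlt/andP; split.
  apply: (@lt_le_trans _ _ (- \sum_(j < i) `|ht (h j)|)%:E); first exact: ltNyr.
  apply: ereal_sup_ubound; exists (- \sum_(j < i) `|ht (h j)|) => //=.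
  exists (fun j : 'I_i => h j); split; first exact/indepP.
  move=> j; rewrite htE ?ht0 // lee_fin lerN2.
  by rewrite (bigD1 j) //=; apply: le_trans (ler_norm _) _; rewrite lerDl sumr_ge0.
apply: (@le_lt_trans _ _ (- C)%:E); last exact: ltry.
apply: ge_ereal_sup => _ [g /= [x [xi xg]] <-].
have xi' : indep (extend x) i.
  apply/indepP; rewrite (_ : (fun j : 'I_i => extend x j) = x) //.
  by apply/funext => j; rewrite extendE.
have xt : nontorsion (x (Ordinal i0)).
  by rewrite -extendE; exact: nontorsion_indep xi' _.
apply: le_trans (xg (Ordinal i0)) _.
by rewrite htE // lee_fin lerN2 hC.
Qed.

Hypothesis Gamma_discrete : discrete_subgroup Gamma.

Lemma ht_minimum (Q : H -> Prop) : (exists x, Q x) -> (forall x, Q x -> nontorsion x) ->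
  exists2 x, Q x & forall y, Q y -> ht x <= ht y.
Proof.
move=> Q0 Qt; have [h hd] := exists_indep; have [_ hu hdn] := spans_of_indep hd.
have [C hC] := ht_bounded.
have [s1 s1P] := finite_cosets (up_gauge rho_up) (@up_ord_Gamma _ _ _) hu.
have [s2 s2P] := finite_cosets (down_gauge rho_down) (@down_ord_Gamma _ _ _) hdn.
apply: (@coset_minimum _ _ Gamma ht [seq a + b | a <- s1, b <- s2] C Q) => //.
  by move=> x /Qt; exact: hC.
move=> x /Qt xt; have [a as1 aG] := s1P _ (phi_up_neq0 xt).
have [b bs2 bG] := s2P _ (phi_down_neq0 xt).
exists (a + b); first exact: allpairs_f.
by rewrite /ht /height opprD addrACA rpredD.
Qed.

Theorem doubly_orthogonal_basis_exists :
  exists e : 'I_d -> H, doubly_orthogonal_basis (P := P) e.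
Proof.
have [e ge] := exists_greedy (@to_up_inj _ _ _) phi_up_indep exists_indep ht_minimum.
have [ed _] := ge; have [hq hu hdn] := spans_of_indep ed.
exists (fun i : 'I_d => e i); split.
  split.
  - split; first exact/(indepP (fun i => to_mod_torsion (e i)))/indep_mod_torsion.
    elim/mod_torsionW => x; apply/(in_spanP (fun i => to_mod_torsion (e i))).
    have [c xc] := greedy_spans (@to_up_inj _ _ _) (@to_down_inj _ _ _)
      phi_up_neq0 phi_down_neq0 (@up_truncation _ _ _) (@down_truncation _ _ _) ge hq x.
    by exists c; apply/mod_torsion_spanP.
  - by apply: (basis_of_indep_span (x := fun i => phi_up B (e i))) => //; exact: phi_up_indep.
  - by apply: (basis_of_indep_span (x := fun i => phi_down B (e i))) => //; exact: phi_down_indep.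
split.
  apply/(up_orthogonalP _ _ (fun i => phi_up B (e i))).
  exact: (greedy_orthogonal (@to_down_inj _ _ _) phi_up_neq0 phi_down_neq0
    (@up_down_ord_le0 _ _ _) (@up_truncation _ _ _) ge).
apply/(down_orthogonalP _ _ (fun i => phi_down B (e i))).
have ge' : greedy (phi1 := phi_down B) (phi2 := phi_up B)
    (down_gauge rho_down) (up_gauge rho_up) e d.
  split => // k kd x xsp; have := ge.2 k kd x xsp.
  by rewrite /height addrC [X in _ <= X]addrC.
apply: (greedy_orthogonal (@to_up_inj _ _ _) phi_down_neq0 phi_up_neq0 _
  (@down_truncation _ _ _) ge').
by move=> a a0; rewrite addrC up_down_ord_le0.
Qed.

End Height.
End MatchedPair.

(** * Comparison of two filtrations *)

Section Comparison.
Context {R : realType} {K : fieldType} {Gamma : zmodClosed R}.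
Variables (B : matched_pair K Gamma) (d : nat) (rank_d : has_rank (mp_H B) d).
Local Notation H := (mp_H B).

Lemma up_distP (V : vectType (novikov_up K Gamma)) (rho rho' : up_norm V) (t : R) :
  (up_dist rho rho' <= t%:E)%E ->
  forall v, v != 0 -> `|up_gauge rho v - up_gauge rho' v| <= t.
Proof.
move=> h v v0; rewrite -lee_fin; apply: le_trans h; apply: ereal_sup_ubound.
by exists v => //=; rewrite (up_rhoE rho v0) (up_rhoE rho' v0).
Qed.

Lemma down_distP (V : vectType (novikov_down K Gamma)) (rho rho' : down_norm V) (t : R) :
  (down_dist rho rho' <= t%:E)%E ->
  forall v, v != 0 -> `|down_gauge rho v - down_gauge rho' v| <= t.
Proof.
move=> h v v0; rewrite -lee_fin; apply: le_trans h; apply: ereal_sup_ubound.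
exists v => //=; rewrite (down_rhoE rho v0) (down_rhoE rho' v0) /=.
by rewrite -opprD normrN.
Qed.

Lemma gap_le (rho_up rho_up' : up_norm (mp_up B))
    (rho_down rho_down' : down_norm (mp_down B)) (t : R) i :
  (forall v, v != 0 -> `|up_gauge rho_up v - up_gauge rho_up' v| <= t) ->
  (forall v, v != 0 -> `|down_gauge rho_down v - down_gauge rho_down' v| <= t) ->
  (gap (FilteredMatchedPair rho_up rho_down) i <=
   gap (FilteredMatchedPair rho_up' rho_down') i + (2 * t)%:E)%E.
Proof.
move=> ht1 ht2; apply: ge_ereal_sup => _ [g /= [x [xi xg]] <-].
rewrite -leeBlDr // -EFinB; apply: ereal_sup_ubound; exists (g - 2 * t) => //=.
exists x; split => // j.
have xi' : indep (extend x) i.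
  apply/indepP; rewrite (_ : (fun k : 'I_i => extend x k) = x) //.
  by apply/funext => k; rewrite extendE.
have xt : x j \notin @torsion (group_algebra K Gamma) H.
  by rewrite -extendE; exact: nontorsion_indep xi' _.
have := xg j; rewrite !htE // !lee_fin /height.
have := ht1 _ (phi_up_neq0 xt); have := ht2 _ (phi_down_neq0 xt).
by rewrite !ler_norml => /andP[? ?] /andP[? ?] ?; lra.
Qed.

Lemma doubly_orthogonal_basisP (rho_up : up_norm (mp_up B))
    (rho_down : down_norm (mp_down B)) (e : 'I_d -> H) :
  doubly_orthogonal_basis (P := FilteredMatchedPair rho_up rho_down) e ->
  [/\ indep (extend e) d,
      forall v, in_span (fun i => to_mod_torsion (extend e i)) d v,
      orthogonal_family (up_gauge rho_up) (fun i => phi_up B (extend e i)) d &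
      orthogonal_family (down_gauge rho_down) (fun i => phi_down B (extend e i)) d].
Proof.
have ee : (fun i : 'I_d => extend e i) = e by apply/funext => i; rewrite extendE.
move=> [[[ei es] _ _] [ho1 ho2]]; split.
- apply/indep_of_mod_torsion/indepP.
  rewrite (_ : (fun i : 'I_d => to_mod_torsion (extend e i)) = fun i => to_mod_torsion (e i)) //.
  by apply/funext => i; rewrite extendE.
- move=> v; apply/in_spanP; have [c ->] := es v; exists c.
  by apply: eq_bigr => i _; rewrite extendE.
- apply/up_orthogonalP; rewrite (_ : (fun i : 'I_d => _) = fun i => phi_up B (e i)) //.
  by apply/funext => i; rewrite extendE.
- apply/down_orthogonalP; rewrite (_ : (fun i : 'I_d => _) = fun i => phi_down B (e i)) //.
  by apply/funext => i; rewrite extendE.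
Qed.

(** When t is infinite any bijection will do. *)
Lemma basis_matching (rho_up rho_up' : up_norm (mp_up B))
    (rho_down rho_down' : down_norm (mp_down B)) (t : \bar R) (e e' : 'I_d -> H) :
  t != -oo%E ->
  (up_dist rho_up rho_up' <= t)%E -> (down_dist rho_down rho_down' <= t)%E ->
  doubly_orthogonal_basis (P := FilteredMatchedPair rho_up rho_down) e ->
  doubly_orthogonal_basis (P := FilteredMatchedPair rho_up' rho_down') e' ->
  exists2 f : 'I_d -> 'I_d, injective f & forall i, exists2 g, g \in Gamma &
    (`|fine (rho_up' (phi_up B (e' (f i)))) + g - fine (rho_up (phi_up B (e i)))|%:E <= t)%E /\
    (`|fine (rho_down' (phi_down B (e' (f i)))) + g - fine (rho_down (phi_down B (e i)))|%:E <= t)%E.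
Proof.
case: t => [t _ /up_distP ut /down_distP dt| _ _ _|//]; last first.
  by move=> _ _; exists id => // i; exists 0; rewrite ?rpred0 // !leey.
move=> /doubly_orthogonal_basisP[ei es ho1 ho2] /doubly_orthogonal_basisP[ei' es' ho1' ho2'].
have [|||f f_inj fP] := @spectra_matching _ _ _ _ _ _ _ _ _ _ _ (phi_up B) (phi_down B)
  (@to_up_inj _ _ _) (@to_down_inj _ _ _) (@phi_up_neq0 _ _ _ B) (@phi_down_neq0 _ _ _ B)
  (@up_down_ord_le0 _ _ _) Gamma t d _ _ _ _ _ _ _ _ _ ho1 ho2 ho1' ho2' ei ei' es es'.
- by move=> a a0; apply: up_ord_Gamma; apply: contra_neq a0 => a0; apply: to_up_inj; rewrite a0; exact: coef_inj.
- by move=> v /ut; rewrite distrC.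
- by move=> v /dt; rewrite distrC.
exists f => // i; have [g gG [h1 h2]] := fP i; exists g => //.
rewrite !extendE in h1 h2; rewrite !lee_fin; split => //.
by move: h2 => /=; rewrite -normrN; congr (`| _ | <= _); lra.
Qed.

End Comparison.

Lemma mod_subgroup_eq (R : realType) (Gamma : zmodClosed R) (a b : R) :
  mod_subgroup Gamma a = mod_subgroup Gamma b <-> a - b \in Gamma.
Proof.
split=> [/eqP|h]; first by rewrite /mod_subgroup -Quotient.idealrBE.
by apply/eqP; rewrite /mod_subgroup -Quotient.idealrBE.
Qed.

Theorem theorem2p1 (R : realType) (K : fieldType) (Gamma : zmodClosed R)
    (Gamma_fg : fg_subgroup Gamma) (B : matched_pair K Gamma)
    (rho_up rho_up' : up_norm (mp_up B))
    (rho_down rho_down' : down_norm (mp_down B))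
    (d : nat) (rank_d : has_rank (mp_H B) d) :
  let P := FilteredMatchedPair rho_up rho_down in
  let P' := FilteredMatchedPair rho_up' rho_down' in
  let t := maxe (down_dist rho_down rho_down') (up_dist rho_up rho_up') in
  (forall i, (1 <= i <= d)%N -> (`|gap P i - gap P' i| <= 2%:E * t)%E) /\
  (discrete_subgroup Gamma ->
     (exists S, is_basis_spectrum P d S) /\
     (exists S', is_basis_spectrum P' d S') /\
     forall S S', is_basis_spectrum P d S -> is_basis_spectrum P' d S' ->
     exists2 sigma : mset_elt S -> mset_elt S', bijective sigma &
     forall (x : mset_elt S) (a : R),
       mod_subgroup Gamma a = (mset_val x).1 ->
       let l := (mset_val x).2 in
       let l' := (mset_val (sigma x)).2 in
       exists a' : R, [/\ mod_subgroup Gamma a' = (mset_val (sigma x)).1,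
         (`|a' - a|%:E <= t)%E &
         (`|(a' + l') - (a + l)|%:E <= t)%E]).
Proof.
move=> P P' t.
have ut : (up_dist rho_up rho_up' <= t)%E by rewrite le_max lexx orbT.
have dt : (down_dist rho_down rho_down' <= t)%E by rewrite le_max lexx.
have [h hd] := exists_indep rank_d.
(* for d > 0 there are nonzero vectors, so that t is not a supremum over the empty set *)
have t0 : (0 < d)%N -> (0 <= t)%E.
  move=> d0; apply: le_trans ut; apply: le_trans (abse_ge0 _) _.
  apply: ereal_sup_ubound; exists (phi_up B (h 0%N)) => //=.
  exact/phi_up_neq0/(nontorsion_indep hd d0).
split=> [i id|disc].
  have [f f'] := (gap_fin rank_d rho_up rho_down id, gap_fin rank_d rho_up' rho_down' id).
  have d0 : (0 < d)%N by have /andP[i0] := id; exact: leq_trans i0.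
  move: (t0 d0) ut dt; clear t0; clearbody t; case: t => [t _ /up_distP ut /down_distP dt|_ _ _|//]; last first.
    by rewrite gt0_muley ?leey // lte_fin.
  have g1 := gap_le i ut dt.
  have g2 : (gap P' i <= gap P i + (2 * t)%:E)%E.
    by apply: gap_le => v v0; rewrite distrC; [exact: ut|exact: dt].
  move: g1 g2; rewrite -/P -/P' -(fineK f) -(fineK f') -!EFinD -EFinM !lee_fin => g1 g2.
  by rewrite ler_norml; apply/andP; split; lra.
have exists_spectrum ru rd : exists S, is_basis_spectrum (@FilteredMatchedPair _ _ _ B ru rd) d S.
  have [e eP] := doubly_orthogonal_basis_exists rank_d ru rd disc.
  by exists (seq_mset [seq spectrum_point (P := FilteredMatchedPair ru rd) (e i) | i <- enum 'I_d]), e.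
split; first exact: exists_spectrum.
split; first exact: exists_spectrum.
move=> S S' [e eP ->] [e' eP' ->] {S S'}.
have [b [c bK cK] bval] := mset_elt_enum (fun i => spectrum_point (P := P) (e i)).
have [b' b'_bij b'val] := mset_elt_enum (fun i => spectrum_point (P := P') (e' i)).
have [f f_inj fP] : exists2 f : 'I_d -> 'I_d, injective f & forall i, exists2 g, g \in Gamma &
    (`|fine (rho_up' (phi_up B (e' (f i)))) + g - fine (rho_up (phi_up B (e i)))|%:E <= t)%E /\
    (`|fine (rho_down' (phi_down B (e' (f i)))) + g - fine (rho_down (phi_down B (e i)))|%:E <= t)%E.
  have [d0|d0] := posnP d; last first.
    apply: basis_matching ut dt eP eP'.
    by apply: contraTneq (t0 d0) => ->.
  by exists id => // i; exfalso; move: i; rewrite d0 => -[].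
exists (b' \o f \o c).
  by apply: bij_comp; [apply: bij_comp => //; exact: injF_bij|exists b].
move=> x a; rewrite -(cK x) /= bK; move: (c x) => i {x}.
rewrite bval b'val /= => /mod_subgroup_eq aG.
have [g gG [h1 h2]] := fP i.
set r1 := fine (rho_up (phi_up B (e i))) in h1 aG *.
set r1' := fine (rho_up' (phi_up B (e' (f i)))) in h1 *.
set r2 := fine (rho_down (phi_down B (e i))) in h2 *.
set r2' := fine (rho_down' (phi_down B (e' (f i)))) in h2 *.
(* the representative a is translated along with its basis vector *)
exists (r1' + g + (a - r1)); split.
- apply/mod_subgroup_eq; rewrite (_ : _ - _ = g + (a - r1)); last lra.
  by rewrite rpredD.
- by rewrite (_ : _ - _ = r1' + g - r1); [exact: h1|lra].
- by rewrite (_ : _ - _ = r2' + g - r2); [exact: h2|lra].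
Qed.
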